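(* Let $\Gamma$ be a countable discrete nilpotent group and $a\in C^\ast(\Gamma)$. Then $a$ is invertible in $C^\ast(\Gamma)$ if and only if $\Phi_{\mathtt I}(a)$ is invertible in $C^\ast(\Gamma)/\mathtt I$ for every $\mathtt I\in\mathrm{Prim}(C^\ast(\Gamma))$.
   Context: $C^\ast(\Gamma)$ is the group $C^\ast$-algebra of $\Gamma$, i.e. the enveloping $C^\ast$-algebra of $\ell^1(\Gamma,\mathbb{C})$. For a $C^\ast$-algebra $\mathcal{A}$, $\mathrm{Prim}(\mathcal{A})$ is the set of primitive ideals, i.e. closed two-sided ideals of the form $\ker(\pi)$ for an irreducible ($^\ast$-)representation $\pi$ of $\mathcal{A}$. For a closed two-sided ideal $\mathtt J$ of $\mathcal{A}$, $\Phi_{\mathtt J}:\mathcal{A}\to\mathcal{A}/\mathtt J$ is the canonical projection. *)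

(* Defs.v *)
From HB Require Import structures.
From mathcomp Require Import all_boot all_order all_algebra.
From mathcomp Require Import sesquilinear complex.
From mathcomp Require Import all_classical all_reals all_analysis.

Set Implicit Arguments.
Unset Strict Implicit.
Unset Printing Implicit Defensive.

Import Order.TTheory GRing.Theory Num.Theory.
Import numFieldNormedType.Exports.

Local Open Scope classical_set_scope.
Local Open Scope complex_scope.
Local Open Scope ring_scope.
Local Open Scope quotient_scope.

(* Norms valued in [R[i]] are real; [rnorm] is the same number in [R] *)
Definition rnorm (R : realType) (V : normedZmodType R[i]) (x : V) : R :=
  complex.Re `|x|.

Section UnorderedSums.
Variables (R : realType) (T : choiceType).
Implicit Types (g h : T -> R) (f : T -> R[i]).

Definition abs_summable g := summable [set: T] (EFin \o g).

(* The unordered sum of a family; junk unless it is absolutely summable. *)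
Definition rsum g : R :=
  fine (\esum_(x in [set: T]) (Num.max (g x) 0)%:E)
  - fine (\esum_(x in [set: T]) (Num.max (- g x) 0)%:E).

Definition cabs_summable f := abs_summable (fun x => rnorm (f x)).

Definition csum f : R[i] :=
  rsum (fun x => complex.Re (f x)) +i* rsum (fun x => complex.Im (f x)).

End UnorderedSums.

Section RealSums.
Variable R : realType.
Implicit Types T : choiceType.

Local Notation esumR g := (\esum_(x in setT) (g x)%:E).

Lemma abs_summableP T (g : T -> R) :
  abs_summable g <-> (esumR (fun x => `|g x|%R) < +oo)%E.
Proof.
rewrite /abs_summable /summable.
by rewrite (eq_esum (b := fun x => (`|g x|%R)%:E)).
Qed.

Lemma abs_summable_le T (g h : T -> R) :
  (forall x, `|g x| <= h x) -> abs_summable h -> abs_summable g.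
Proof.
move=> gh /abs_summableP hs; apply/abs_summableP; apply: le_lt_trans hs.
apply: le_esum => x _; rewrite lee_fin.
by apply: le_trans (gh x) _; exact: ler_norm.
Qed.

Lemma abs_summableD T (g h : T -> R) :
  abs_summable g -> abs_summable h -> abs_summable (fun x => g x + h x).
Proof. by move=> gs hs; have := summableD gs hs. Qed.

Lemma abs_summableB T (g h : T -> R) :
  abs_summable g -> abs_summable h -> abs_summable (fun x => g x - h x).
Proof. by move=> gs hs; have := summableB gs hs. Qed.

Lemma esumR_fin T (g : T -> R) : abs_summable g -> (forall x, 0 <= g x) ->
  esumR g \is a fin_num.
Proof.
move=> gs g0; rewrite ge0_fin_numE; last by apply: esum_ge0 => x _; rewrite lee_fin.
move/abs_summableP : gs; rewrite (eq_esum (b := fun x => (g x)%:E))// => x _.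
by rewrite ger0_norm.
Qed.

Lemma esumR_finP T (g : T -> R) : (forall x, 0 <= g x) ->
  (esumR g < +oo)%E -> abs_summable g.
Proof.
move=> g0 gs; apply/abs_summableP.
by rewrite (eq_esum (b := fun x => (g x)%:E))// => x _; rewrite ger0_norm.
Qed.

Let esumZ_le T (c : R) (g : T -> R) : 0 <= c -> (forall x, 0 <= g x) ->
  (esumR (fun x => (c * g x)%R) <= c%:E * esumR g)%E.
Proof.
move=> c0 g0; apply: ge_ereal_sup => _ [A [finA _] <-].
rewrite (eq_fsbigr (fun x => c%:E * (g x)%:E)%E); last by move=> x _; rewrite EFinM.
rewrite -ge0_mule_fsumr; last by move=> x; rewrite lee_fin.
apply: lee_wpmul2l; first by rewrite lee_fin.
by apply: ereal_sup_ubound; exists A.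
Qed.

Lemma esumRZ T (c : R) (g : T -> R) : 0 <= c -> (forall x, 0 <= g x) ->
  (esumR (fun x => (c * g x)%R) = c%:E * esumR g)%E.
Proof.
move=> c0 g0; apply/eqP; rewrite eq_le esumZ_le//=.
have [->|cn0] := eqVneq c 0.
  by rewrite mul0e; apply: esum_ge0 => x _; rewrite mul0r.
have cgt : 0 < c by rewrite lt_neqAle eq_sym cn0.
rewrite -lee_pdivlMl//.
have : (esumR (fun x => (c^-1 * (c * g x))%R) <=
    c^-1%:E * esumR (fun x => (c * g x)%R))%E.
  by apply: esumZ_le => [|x]; rewrite ?invr_ge0// mulr_ge0.
by under eq_esum do rewrite mulKf//.
Qed.

Lemma abs_summableZ T (c : R) (g : T -> R) :
  abs_summable g -> abs_summable (fun x => c * g x).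
Proof.
move=> gs; apply/abs_summableP.
rewrite (eq_esum (b := fun x => (`|c| * `|g x|)%:E)); last first.
  by move=> x _; rewrite normrM.
by rewrite esumRZ//; apply: lte_mul_pinfty => //; exact/abs_summableP.
Qed.

Lemma rsum_sub T (g p q : T -> R) : abs_summable p -> abs_summable q ->
  (forall x, 0 <= p x) -> (forall x, 0 <= q x) ->
  (forall x, g x = p x - q x) -> rsum g = fine (esumR p) - fine (esumR q).
Proof.
move=> ps qs p0 q0 /funext ->.
have pqs : abs_summable (fun x => p x - q x) by exact: abs_summableB.
set k := (fun x => p x - q x) in pqs *.
have fp : \esum_(x in [set: T]) ((EFin \o k)^\+ x)%E \is a fin_num.
  have := summable_funepos pqs; rewrite summableE.
  by rewrite (eq_esum (b := ((EFin \o k)^\+)%E))// => x _; rewrite gee0_abs.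
have fn : \esum_(x in [set: T]) ((EFin \o k)^\- x)%E \is a fin_num.
  have := summable_funeneg pqs; rewrite summableE.
  by rewrite (eq_esum (b := ((EFin \o k)^\-)%E))// => x _; rewrite gee0_abs.
rewrite /rsum.
have -> : (fun x => (Num.max (p x - q x) 0)%:E) = (EFin \o k)^\+%E.
  by apply/funext => x; rewrite funeposE /= EFin_max.
have -> : (fun x => (Num.max (- (p x - q x)) 0)%:E) = (EFin \o k)^\-%E.
  by apply/funext => x; rewrite funenegE /= EFin_max.
rewrite -fineB// -fineB ?esumR_fin//; congr fine.
by apply: (esumB ps qs) => x _; rewrite lee_fin.
Qed.

Definition rpos T (g : T -> R) x := Num.max (g x) 0.
Definition rneg T (g : T -> R) x := Num.max (- g x) 0.

Lemma rpos_ge0 T (g : T -> R) x : 0 <= rpos g x.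
Proof. by rewrite /rpos le_max lexx orbT. Qed.
Lemma rneg_ge0 T (g : T -> R) x : 0 <= rneg g x.
Proof. by rewrite /rneg le_max lexx orbT. Qed.
Lemma rposnegE T (g : T -> R) x : g x = rpos g x - rneg g x.
Proof.
rewrite /rpos /rneg; have [g0|g0] := leP 0 (g x).
  by rewrite max_r ?oppr_le0// subr0.
by rewrite max_l ?sub0r ?opprK// oppr_ge0 ltW.
Qed.
Lemma rpos_le T (g : T -> R) x : `|rpos g x| <= `|g x|.
Proof.
by rewrite ger0_norm ?rpos_ge0// /rpos ge_max normr_ge0 ler_norm.
Qed.
Lemma rneg_le T (g : T -> R) x : `|rneg g x| <= `|g x|.
Proof.
by rewrite ger0_norm ?rneg_ge0// /rneg ge_max normr_ge0 -normrN ler_norm.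
Qed.

Lemma abs_summable_le_norm T (g h : T -> R) :
  (forall x, `|g x| <= `|h x|) -> abs_summable h -> abs_summable g.
Proof.
move=> gh /abs_summableP hs; apply/abs_summableP; apply: le_lt_trans hs.
by apply: le_esum => x _; rewrite lee_fin.
Qed.

Lemma rpos_summable T (g : T -> R) : abs_summable g -> abs_summable (rpos g).
Proof. by apply: abs_summable_le_norm => x; exact: rpos_le. Qed.
Lemma rneg_summable T (g : T -> R) : abs_summable g -> abs_summable (rneg g).
Proof. by apply: abs_summable_le_norm => x; exact: rneg_le. Qed.

Lemma rsumE T (g : T -> R) : abs_summable g ->
  rsum g = fine (esumR (rpos g)) - fine (esumR (rneg g)).
Proof.
move=> gs; apply: rsum_sub.
- exact: rpos_summable.
- exact: rneg_summable.
- exact: rpos_ge0.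
- exact: rneg_ge0.
- exact: rposnegE.
Qed.

Lemma esumRD T (g h : T -> R) : (forall x, 0 <= g x) -> (forall x, 0 <= h x) ->
  (esumR (fun x => (g x + h x)%R) = esumR g + esumR h)%E.
Proof. by move=> g0 h0; rewrite -esumD// => x _; rewrite lee_fin. Qed.

Lemma rsumD T (g h : T -> R) : abs_summable g -> abs_summable h ->
  rsum (fun x => g x + h x) = rsum g + rsum h.
Proof.
move=> gs hs.
have [gp gn] := (rpos_summable gs, rneg_summable gs).
have [hp hn] := (rpos_summable hs, rneg_summable hs).
rewrite (@rsum_sub _ _ (fun x => rpos g x + rpos h x)
  (fun x => rneg g x + rneg h x)).
- rewrite !esumRD; try by move=> x; rewrite ?rpos_ge0 ?rneg_ge0.
  rewrite !fineD ?esumR_fin//; try by move=> x; rewrite ?rpos_ge0 ?rneg_ge0.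
  by rewrite !rsumE// opprD addrACA.
- exact: abs_summableD.
- exact: abs_summableD.
- by move=> x; rewrite addr_ge0// rpos_ge0.
- by move=> x; rewrite addr_ge0// rneg_ge0.
- by move=> x; rewrite opprD addrACA -!rposnegE.
Qed.

Lemma rsumZ T (c : R) (g : T -> R) : abs_summable g ->
  rsum (fun x => c * g x) = c * rsum g.
Proof.
move=> gs; have [gp gn] := (rpos_summable gs, rneg_summable gs).
have p0 := rpos_ge0 g; have n0 := rneg_ge0 g.
have [c0|c0] := leP 0 c.
  rewrite (@rsum_sub _ _ (fun x => c * rpos g x) (fun x => c * rneg g x)).
  - by rewrite !esumRZ// !fineM ?esumR_fin// rsumE// mulrBr.
  - exact: abs_summableZ.
  - exact: abs_summableZ.
  - by move=> x; rewrite mulr_ge0.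
  - by move=> x; rewrite mulr_ge0.
  - by move=> x; rewrite -mulrBr -rposnegE.
have c0' : 0 <= - c by rewrite oppr_ge0 ltW.
rewrite (@rsum_sub _ _ (fun x => - c * rneg g x) (fun x => - c * rpos g x)).
- by rewrite !esumRZ// !fineM ?esumR_fin// rsumE// -mulrBr mulNr -mulrN opprB.
- exact: abs_summableZ.
- exact: abs_summableZ.
- by move=> x; rewrite mulr_ge0.
- by move=> x; rewrite mulr_ge0.
- by move=> x; rewrite -mulrBr mulNr -mulrN opprB -rposnegE.
Qed.

Lemma rsum_reindex T T' (e : T -> T') (g : T' -> R) : bijective e ->
  rsum g = rsum (fun x => g (e x)).
Proof.
rewrite -setTT_bijective => be; rewrite /rsum.
congr (fine _ - fine _).
  exact: (@reindex_esum R T T' setT setT e (fun x => (Num.max (g x) 0)%:E) be).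
exact: (@reindex_esum R T T' setT setT e (fun x => (Num.max (- g x) 0)%:E) be).
Qed.

Lemma abs_summable_reindex T T' (e : T -> T') (g : T' -> R) : bijective e ->
  abs_summable g -> abs_summable (fun x => g (e x)).
Proof.
rewrite -setTT_bijective => be /abs_summableP gs; apply/abs_summableP.
by rewrite (@reindex_esum R T T' setT setT e (fun x => (`|g x|)%:E) be) in gs.
Qed.

Lemma rsum_abs_le T (g : T -> R) : abs_summable g ->
  `|rsum g| <= fine (esumR (fun x => `|g x|%R)).
Proof.
move=> gs; rewrite rsumE//.
have [gp gn] := (rpos_summable gs, rneg_summable gs).
have p0 := rpos_ge0 g; have n0 := rneg_ge0 g.
have -> : (fun x => (`|g x|)%:E) = (fun x => (rpos g x + rneg g x)%:E).
  apply/funext => x; rewrite /rpos /rneg; have [h|h] := leP 0 (g x).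
    by rewrite max_r ?oppr_le0// addr0 ger0_norm.
  by rewrite max_l ?add0r ?ltr0_norm// oppr_ge0 ltW.
rewrite esumRD// fineD ?esumR_fin//.
apply: le_trans (ler_normB _ _) _.
by rewrite !ger0_norm ?fine_ge0//; apply: esum_ge0 => x _; rewrite lee_fin.
Qed.

Section Fubini.
Variables (T1 T2 : choiceType) (g : T1 -> T2 -> R).
Hypothesis gs : (\esum_(x in [set: T1]) esumR (fun y => `|g x y|%R) < +oo)%E.

Lemma fubini_row x : abs_summable (g x).
Proof.
apply/abs_summableP; apply: le_lt_trans gs.
rewrite -[leLHS](@esum_set1 R T1 x (fun x => esumR (fun y => `|g x y|%R))); last first.
  by apply: esum_ge0 => y _; rewrite lee_fin.
rewrite (esum_mkcond [set x]).
apply: le_esum => z _; case: ifPn => // _.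
by apply: esum_ge0 => y _; rewrite lee_fin.
Qed.

Lemma fubini_rsum_row : abs_summable (fun x => rsum (g x)).
Proof.
apply/abs_summableP; apply: le_lt_trans gs; apply: le_esum => x _.
apply: (@le_trans _ _ (fine (esumR (fun y => `|g x y|%R)))%:E).
  by rewrite lee_fin; apply: rsum_abs_le; exact: fubini_row.
rewrite fineK// ge0_fin_numE; first exact/abs_summableP/fubini_row.
by apply: esum_ge0 => y _; rewrite lee_fin.
Qed.

Lemma fubini_iter : rsum (fun x => rsum (g x)) =
  fine (\esum_(x in [set: T1]) esumR (rpos (g x)))
  - fine (\esum_(x in [set: T1]) esumR (rneg (g x))).
Proof.
have row := fubini_row.
have dominated (h : T1 -> T2 -> R) :
    (forall x y, 0 <= h x y) -> (forall x y, `|h x y| <= `|g x y|) ->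
    (forall x, esumR (h x) = (fine (esumR (h x)))%:E) /\
    abs_summable (fun x => fine (esumR (h x))).
  move=> h0 hg.
  have hE x : esumR (h x) = (fine (esumR (h x)))%:E.
    by rewrite fineK// esumR_fin//; apply: abs_summable_le_norm (hg x) _.
  split => //; apply: esumR_finP.
    by move=> x; apply: fine_ge0; apply: esum_ge0 => y _; rewrite lee_fin.
  apply: le_lt_trans gs; apply: le_esum => x _; rewrite -hE.
  by apply: le_esum => y _; rewrite lee_fin -[leLHS]ger0_norm.
have [pE ps] := dominated _ (fun x => @rpos_ge0 _ (g x)) (fun x => @rpos_le _ (g x)).
have [nE ns] := dominated _ (fun x => @rneg_ge0 _ (g x)) (fun x => @rneg_le _ (g x)).
rewrite (rsum_sub ps ns).
- by congr (fine _ - fine _); apply: eq_esum => x _.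
- by move=> x; apply: fine_ge0; apply: esum_ge0 => y _; rewrite lee_fin rpos_ge0.
- by move=> x; apply: fine_ge0; apply: esum_ge0 => y _; rewrite lee_fin rneg_ge0.
- by move=> x; rewrite rsumE.
Qed.

End Fubini.

Lemma esum_swap T1 T2 (a : T1 -> T2 -> \bar R) : (forall x y, 0 <= a x y)%E ->
  \esum_(x in [set: T1]) \esum_(y in [set: T2]) a x y =
  \esum_(y in [set: T2]) \esum_(x in [set: T1]) a x y.
Proof.
move=> a0; rewrite !esum_esum//.
have sb : set_bij ([set: T1] `*`` (fun=> [set: T2])) ([set: T2] `*`` (fun=> [set: T1]))
    (fun p : T1 * T2 => (p.2, p.1)).
  by split => //= [[x y] [x' y'] _ _ [-> ->]//|[y x] _]; exists (x, y).
by rewrite (@reindex_esum _ _ _ _ _ _ _ sb).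
Qed.

Lemma rsum_swap T1 T2 (g : T1 -> T2 -> R) :
  (\esum_(x in [set: T1]) \esum_(y in [set: T2]) (`|g x y|)%:E < +oo)%E ->
  rsum (fun x => rsum (g x)) = rsum (fun y => rsum (fun x => g x y)).
Proof.
move=> gs; rewrite !fubini_iter//; last by rewrite -esum_swap// => y x; rewrite lee_fin.
congr (fine _ - fine _); rewrite esum_swap// => x y.
  by rewrite lee_fin rpos_ge0.
by rewrite lee_fin rneg_ge0.
Qed.

End RealSums.

Section ComplexSums.
Variable R : realType.
Implicit Types (T : choiceType) (z w : R[i]).

Lemma rnorm_normc z : rnorm z = ComplexField.Normc.normc z.
Proof. by []. Qed.

Lemma rnorm_ge0 z : 0 <= rnorm z.
Proof. by rewrite rnorm_normc; case: z => a b; exact: sqrtr_ge0. Qed.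

Lemma rnorm0 : rnorm (0 : R[i]) = 0.
Proof. by rewrite /rnorm normr0. Qed.

Lemma rnormM z w : rnorm (z * w) = rnorm z * rnorm w.
Proof. by rewrite !rnorm_normc ComplexField.Normc.normcM. Qed.

Lemma rnormD z w : rnorm (z + w) <= rnorm z + rnorm w.
Proof. by rewrite !rnorm_normc le_normcD. Qed.

Lemma rnorm_conj z : rnorm (Num.conj z) = rnorm z.
Proof. by rewrite /rnorm norm_conjC. Qed.

Lemma Re_le_rnorm z : `|complex.Re z| <= rnorm z.
Proof.
rewrite rnorm_normc; case: z => a b /=; rewrite -sqrtr_sqr.
by rewrite ler_sqrt ?addr_ge0 ?sqr_ge0// lerDl sqr_ge0.
Qed.

Lemma Im_le_rnorm z : `|complex.Im z| <= rnorm z.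
Proof.
rewrite rnorm_normc; case: z => a b /=; rewrite -sqrtr_sqr.
by rewrite ler_sqrt ?addr_ge0 ?sqr_ge0// lerDr sqr_ge0.
Qed.

Lemma rnorm_le_ReIm z : rnorm z <= `|complex.Re z| + `|complex.Im z|.
Proof.
rewrite rnorm_normc; case: z => a b /=.
rewrite -(@ger0_norm _ (`|a| + `|b|)) ?addr_ge0// -sqrtr_sqr.
rewrite ler_sqrt ?sqr_ge0// sqrrD !real_normK ?num_real//.
by rewrite lerD2r lerDl mulrn_wge0// mulr_ge0.
Qed.

Lemma csummableP T (f : T -> R[i]) : cabs_summable f <->
  (\esum_(x in [set: T]) (rnorm (f x))%:E < +oo)%E.
Proof.
rewrite /cabs_summable abs_summableP.
by rewrite (eq_esum (b := fun x => (rnorm (f x))%:E))// => x _; rewrite ger0_norm ?rnorm_ge0.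
Qed.

Lemma csummable_Re T (f : T -> R[i]) : cabs_summable f ->
  abs_summable (fun x => complex.Re (f x)).
Proof. by apply: abs_summable_le => x; exact: Re_le_rnorm. Qed.

Lemma csummable_Im T (f : T -> R[i]) : cabs_summable f ->
  abs_summable (fun x => complex.Im (f x)).
Proof. by apply: abs_summable_le => x; exact: Im_le_rnorm. Qed.

Lemma csummable_le T (f : T -> R[i]) (h : T -> R) :
  (forall x, rnorm (f x) <= h x) -> abs_summable h -> cabs_summable f.
Proof.
move=> fh; apply: abs_summable_le => x; rewrite ger0_norm ?rnorm_ge0//.
Qed.

Lemma csummable0 T : cabs_summable (fun _ : T => 0 : R[i]).
Proof. by apply/csummableP; rewrite esum1// => x _; rewrite rnorm0. Qed.

Lemma csummableD T (f g : T -> R[i]) : cabs_summable f -> cabs_summable g ->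
  cabs_summable (fun x => f x + g x).
Proof.
move=> fs gs; apply: csummable_le (abs_summableD fs gs) => x; exact: rnormD.
Qed.

Lemma csummableZ T (c : R[i]) (f : T -> R[i]) : cabs_summable f ->
  cabs_summable (fun x => c * f x).
Proof.
by move=> fs; apply: csummable_le (abs_summableZ (rnorm c) fs) => x; rewrite rnormM.
Qed.

Lemma csummable_reindex T T' (e : T -> T') (f : T' -> R[i]) : bijective e ->
  cabs_summable f -> cabs_summable (fun x => f (e x)).
Proof. by move=> be fs; exact: (abs_summable_reindex be fs). Qed.

Lemma csummable_conj T (f : T -> R[i]) : cabs_summable f ->
  cabs_summable (fun x => Num.conj (f x)).
Proof. by move=> fs; apply: csummable_le fs => x; rewrite rnorm_conj. Qed.

Lemma complexP z w : complex.Re z = complex.Re w -> complex.Im z = complex.Im w ->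
  z = w.
Proof. by case: z w => [a b] [c d] /= -> ->. Qed.

Lemma csumD T (f g : T -> R[i]) : cabs_summable f -> cabs_summable g ->
  csum (fun x => f x + g x) = csum f + csum g.
Proof.
move=> fs gs; have [fr fi] := (csummable_Re fs, csummable_Im fs).
have [gr gi] := (csummable_Re gs, csummable_Im gs).
apply: complexP => /=; rewrite -rsumD//.
  by congr rsum; apply/funext => x; case: (f x) => ? ?; case: (g x).
by congr rsum; apply/funext => x; case: (f x) => ? ?; case: (g x).
Qed.

Lemma csumZ T (c : R[i]) (f : T -> R[i]) : cabs_summable f ->
  csum (fun x => c * f x) = c * csum f.
Proof.
move=> fs; have [fr fi] := (csummable_Re fs, csummable_Im fs).
case: c => a b; rewrite {2}/csum; apply: complexP => /=.
  rewrite -mulNr -!rsumZ// -rsumD; [|exact: abs_summableZ..].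
  by congr rsum; apply/funext => x; case: (f x) => ? ? /=; rewrite mulNr.
rewrite -!rsumZ// -rsumD; [|exact: abs_summableZ..].
by congr rsum; apply/funext => x; case: (f x).
Qed.

Lemma csum_conj T (f : T -> R[i]) : cabs_summable f ->
  csum (fun x => Num.conj (f x)) = Num.conj (csum f).
Proof.
move=> fs; have fi := csummable_Im fs; apply: complexP => /=.
  by congr rsum; apply/funext => x; case: (f x).
rewrite -mulN1r -rsumZ//; congr rsum; apply/funext => x.
by case: (f x) => ? ? /=; rewrite mulN1r.
Qed.

Lemma csum_reindex T T' (e : T -> T') (f : T' -> R[i]) : bijective e ->
  csum f = csum (fun x => f (e x)).
Proof.
by move=> be; rewrite /csum; congr (_ +i* _); rewrite (rsum_reindex _ be).
Qed.

Lemma csum_swap T1 T2 (f : T1 -> T2 -> R[i]) :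
  (\esum_(x in [set: T1]) \esum_(y in [set: T2]) (rnorm (f x y))%:E < +oo)%E ->
  csum (fun x => csum (f x)) = csum (fun y => csum (fun x => f x y)).
Proof.
move=> fs; apply: complexP => /=; apply: rsum_swap; apply: le_lt_trans fs;
  do 2 (apply: le_esum => ? _); rewrite lee_fin.
  exact: Re_le_rnorm.
exact: Im_le_rnorm.
Qed.

Lemma rnorm_csum_le T (f : T -> R[i]) : cabs_summable f ->
  ((rnorm (csum f))%:E <= 2%:E * \esum_(x in [set: T]) (rnorm (f x))%:E)%E.
Proof.
move=> fs; have [fr fi] := (csummable_Re fs, csummable_Im fs).
have le1 (g : T -> R) : abs_summable g -> (forall x, `|g x| <= rnorm (f x)) ->
    (`|rsum g|%:E <= \esum_(x in [set: T]) (rnorm (f x))%:E)%E.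
  move=> gs gf; apply: (@le_trans _ _ (\esum_(x in [set: T]) (`|g x|)%:E)).
    rewrite -[leRHS]fineK ?lee_fin ?rsum_abs_le// ge0_fin_numE.
      exact/abs_summableP.
    by apply: esum_ge0 => x _; rewrite lee_fin.
  by apply: le_esum => x _; rewrite lee_fin.
apply: (@le_trans _ _ (`|rsum (fun x => complex.Re (f x))|%:E
    + `|rsum (fun x => complex.Im (f x))|%:E)).
  by rewrite -EFinD lee_fin; exact: rnorm_le_ReIm.
rewrite (_ : 2%:E = 1 + 1)%E// ge0_muleDl// !mul1e.
apply: leeD; apply: le1 => // x; [exact: Re_le_rnorm|exact: Im_le_rnorm].
Qed.

Lemma rsum_single T (t : T) (g : T -> R) : (forall x, x != t -> g x = 0) ->
  rsum g = g t.
Proof.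
move=> g0; rewrite [RHS]rposnegE /rsum.
have E (h : T -> R) : (forall x, 0 <= h x) -> (forall x, x != t -> h x = 0) ->
    fine (\esum_(x in [set: T]) (h x)%:E) = h t.
  move=> h0 ht; rewrite -[RHS]/(fine (h t)%:E); congr fine.
  rewrite -(@esum_set1 R T t (fun x => (h x)%:E)) ?lee_fin//.
  rewrite [RHS]esum_mkcond; apply: eq_esum => x _.
  have [->|xt] := eqVneq x t; first by rewrite mem_set.
  by rewrite memNset ?ht//= => /eqP; rewrite (negPf xt).
rewrite (E (rpos g) (rpos_ge0 g)) ?(E (rneg g) (rneg_ge0 g))// => x /g0 gx.
  by rewrite /rneg gx oppr0 maxxx.
by rewrite /rpos gx maxxx.
Qed.

Lemma csum_single T (t : T) (f : T -> R[i]) : (forall x, x != t -> f x = 0) ->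
  csum f = f t.
Proof.
by move=> f0; apply: complexP => /=; apply: rsum_single => x /f0 ->.
Qed.

End ComplexSums.

HB.mixin Record isStarAlgebra (R : realType) A & GRing.Algebra R[i] A := {
  star : A -> A ;
  starD : {morph star : x y / x + y} ;
  starZ : forall (c : R[i]) (x : A), star (c *: x) = Num.conj c *: star x ;
  starM : forall x y : A, star (x * y) = star y * star x ;
  starK : involutive star }.

#[short(type="starAlgType")]
HB.structure Definition StarAlgebra (R : realType) :=
  { A of GRing.Algebra R[i] A & isStarAlgebra R A }.

Section Ell1.
Variables (R : realType) (G : groupType).
Local Notation C := R[i].

Definition ell1_pred : {pred G -> C} := fun f => `[< cabs_summable f >].

Lemma ell1_predP (f : G -> C) : (f \in ell1_pred) <-> cabs_summable f.
Proof. by rewrite unfold_in; split=> /asboolP. Qed.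

Lemma ell1_submod_closed : submod_closed ell1_pred.
Proof.
split; first by apply/ell1_predP; exact: csummable0.
move=> c f g /ell1_predP fs /ell1_predP gs; apply/ell1_predP.
exact: (csummableD (csummableZ c fs) gs).
Qed.

HB.instance Definition _ :=
  GRing.isSubmodClosed.Build C (G -> C) ell1_pred ell1_submod_closed.

Record ell1 : Type := Ell1 { ell1_val :> G -> C ; _ : ell1_val \in ell1_pred }.

HB.instance Definition _ := [isSub for ell1_val].
HB.instance Definition _ := [Choice of ell1 by <:].
HB.instance Definition _ := [SubChoice_isSubLmodule of ell1 by <:].

Lemma ell1P (f : ell1) : cabs_summable f.
Proof. by have /ell1_predP := valP f. Qed.

Lemma ell1_eq (f g : ell1) : (forall x, f x = g x) -> f = g.
Proof. by move=> fg; apply/val_inj/funext. Qed.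

Definition conv (f g : G -> C) (x : G) : C :=
  csum (fun y : G => f y * g (y^-1 * x)%g).

Lemma mulg_bij (a : G) : bijective (fun x : G => (a * x)%g).
Proof. by exists (fun x => (a^-1 * x)%g) => x; rewrite (mulKg, mulVKg). Qed.

Lemma invg_bij : bijective (fun x : G => (x^-1)%g).
Proof. by exists (fun x => (x^-1)%g) => x; rewrite invgK. Qed.

Local Notation norm1 f := (\esum_(x in [set: G]) (rnorm (f x : C))%:E).

Lemma norm1_fin (f : ell1) : (norm1 f < +oo)%E.
Proof. by have /csummableP := ell1P f. Qed.

Lemma norm1_shift (f : G -> C) (a : G) : norm1 (fun x => f (a * x)%g) = norm1 f.
Proof.
have := mulg_bij a; rewrite -setTT_bijective => be.
by rewrite -(@reindex_esum R G G setT setT _ (fun x => (rnorm (f x))%:E) be).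
Qed.

Lemma rnorm_le_norm1 (f : ell1) (x : G) : rnorm (f x) <= fine (norm1 f).
Proof.
have h0 : (0 <= norm1 f)%E by apply: esum_ge0 => y _; rewrite lee_fin rnorm_ge0.
rewrite -lee_fin fineK ?ge0_fin_numE ?norm1_fin//.
rewrite -(@esum_set1 R G x (fun x => (rnorm (f x))%:E)) ?lee_fin ?rnorm_ge0//.
rewrite esum_mkcond; apply: le_esum => y _; case: ifPn => // _.
by rewrite lee_fin rnorm_ge0.
Qed.

Lemma esum_conv (f g : ell1) :
  (\esum_(y in [set: G]) \esum_(x in [set: G])
     (rnorm (f y * g (y^-1 * x)%g))%:E < +oo)%E.
Proof.
rewrite (eq_esum (b := fun y => (fine (norm1 g) * rnorm (f y))%:E)).
  rewrite esumRZ ?fine_ge0//; last 2 first.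
  - by apply: esum_ge0 => y _; rewrite lee_fin rnorm_ge0.
  - by move=> x; exact: rnorm_ge0.
  apply: lte_mul_pinfty => //; last exact: norm1_fin.
  by rewrite lee_fin fine_ge0// esum_ge0// => y _; rewrite lee_fin rnorm_ge0.
move=> y _.
rewrite (eq_esum (b := fun x => (rnorm (f y) * rnorm (g (y^-1 * x)%g))%:E)).
  rewrite esumRZ ?rnorm_ge0//; last by move=> x; exact: rnorm_ge0.
  rewrite (norm1_shift g) mulrC EFinM fineK// ge0_fin_numE ?norm1_fin//.
  by apply: esum_ge0 => x _; rewrite lee_fin rnorm_ge0.
by move=> x _; rewrite rnormM.
Qed.

Lemma conv_summand (f g : ell1) (x : G) :
  cabs_summable (fun y => f y * g (y^-1 * x)%g).
Proof.
apply: (@csummable_le _ _ _ (fun y => fine (norm1 g) * rnorm (f y))).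
  move=> y; rewrite rnormM mulrC ler_wpM2r ?rnorm_ge0//.
  exact: rnorm_le_norm1.
by apply: abs_summableZ; exact: (ell1P f).
Qed.

Lemma conv_ell1 (f g : ell1) : conv f g \in ell1_pred.
Proof.
apply/ell1_predP/csummableP.
apply: (@le_lt_trans _ _ (2%:E * \esum_(x in [set: G]) \esum_(y in [set: G])
     (rnorm (f y * g (y^-1 * x)%g))%:E))%E; last first.
  apply: lte_mul_pinfty => //; rewrite esum_swap ?esum_conv// => x y.
  by rewrite lee_fin rnorm_ge0.
have inner_fin x : \esum_(y in [set: G]) (rnorm (f y * g (y^-1 * x)%g))%:E \is a fin_num.
  rewrite ge0_fin_numE; first by have /csummableP := conv_summand f g x.
  by apply: esum_ge0 => y _; rewrite lee_fin rnorm_ge0.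
under [X in (_ <= _ * X)%E]eq_esum do rewrite -(fineK (inner_fin _)).
rewrite -esumRZ//; last first.
  by move=> x; apply: fine_ge0; apply: esum_ge0 => y _; rewrite lee_fin rnorm_ge0.
apply: le_esum => x _; rewrite EFinM fineK//.
by apply: rnorm_csum_le; exact: (conv_summand f g x).
Qed.

Definition ell1_mul (f g : ell1) : ell1 := Ell1 (conv_ell1 f g).

Definition delta1 (x : G) : C := if x == 1%g then 1 else 0.

Lemma delta1_ell1 : delta1 \in ell1_pred.
Proof.
apply/ell1_predP/csummableP.
suff -> : (\esum_(x in [set: G]) (rnorm (delta1 x))%:E =
           \esum_(x in [set 1%g]) (rnorm (delta1 x))%:E)%E.
  by rewrite esum_set1 ?ltry// lee_fin rnorm_ge0.
rewrite [RHS]esum_mkcond; apply: eq_esum => x _.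
have [->|x1] := eqVneq x 1%g; first by rewrite mem_set.
rewrite memNset /delta1 ?(negPf x1) ?rnorm0//= => /eqP.
by rewrite (negPf x1).
Qed.

Definition ell1_one : ell1 := Ell1 delta1_ell1.

Lemma ell1_star_subproof (f : ell1) : (fun x => Num.conj (f x^-1%g)) \in ell1_pred.
Proof.
by apply/ell1_predP/csummable_conj/(csummable_reindex invg_bij); exact: (ell1P f).
Qed.

Definition ell1_star (f : ell1) : ell1 := Ell1 (ell1_star_subproof f).

Lemma ell1_mulA : associative ell1_mul.
Proof.
move=> f g h; apply: ell1_eq => x; rewrite /= /conv /=.
have E w : conv f g w * h (w^-1 * x)%g =
    csum (fun y => f y * g (y^-1 * w)%g * h (w^-1 * x)%g).
  rewrite mulrC -csumZ; last exact: conv_summand.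
  by congr csum; apply/funext => y; rewrite mulrC.
transitivity (csum (fun w => csum (fun y => f y * g (y^-1 * w)%g * h (w^-1 * x)%g)));
  last by congr csum; apply/funext => w; rewrite -E.
rewrite csum_swap.
  congr csum; apply/funext => y; rewrite -csumZ; last exact: conv_summand.
  rewrite [RHS](csum_reindex _ (mulg_bij y)); congr csum; apply/funext => z.
  by rewrite mulKg invgM mulrA mulgA.
have h0 : 0 <= fine (norm1 h).
  by rewrite fine_ge0// esum_ge0// => y _; rewrite lee_fin rnorm_ge0.
apply: (@le_lt_trans _ _ (\esum_(w in [set: G]) \esum_(y in [set: G])
     (fine (norm1 h) * rnorm (f y * g (y^-1 * w)%g))%:E)%E).
  do 2 (apply: le_esum => ? _); rewrite lee_fin rnormM mulrC.
  by rewrite ler_wpM2r ?rnorm_ge0// rnorm_le_norm1.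
rewrite esum_swap; last by move=> *; rewrite lee_fin mulr_ge0// rnorm_ge0.
have inner_fin y : \esum_(w in [set: G]) (rnorm (f y * g (y^-1 * w)%g))%:E \is a fin_num.
  rewrite ge0_fin_numE; last by apply: esum_ge0 => w _; rewrite lee_fin rnorm_ge0.
  apply: le_lt_trans (esum_conv f g).
  rewrite -[leLHS](@esum_set1 R G y (fun y => \esum_(w in [set: G]) (rnorm (f y * g (y^-1 * w)%g))%:E)); last first.
    by apply: esum_ge0 => w _; rewrite lee_fin rnorm_ge0.
  rewrite (esum_mkcond [set y]); apply: le_esum => z _; case: ifPn => // _.
  by apply: esum_ge0 => w _; rewrite lee_fin rnorm_ge0.
rewrite (eq_esum (b := fun y => (fine (norm1 h) *
    fine (\esum_(w in [set: G]) (rnorm (f y * g (y^-1 * w)%g))%:E))%:E)).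
  rewrite esumRZ//; last first.
    by move=> y; apply: fine_ge0; apply: esum_ge0 => w _; rewrite lee_fin rnorm_ge0.
  apply: lte_mul_pinfty => //.
  by under eq_esum do rewrite fineK//; exact: esum_conv.
move=> y _; rewrite esumRZ//; last by move=> w; exact: rnorm_ge0.
by rewrite -[X in (_ * X)%E = _](fineK (inner_fin y)).
Qed.

Lemma ell1_mul1f : left_id ell1_one ell1_mul.
Proof.
move=> f; apply: ell1_eq => x; rewrite /= /conv (@csum_single _ _ 1%g) /delta1.
  by rewrite eqxx mul1r invg1 mul1g.
by move=> y /negPf ->; rewrite mul0r.
Qed.

Lemma ell1_mulf1 : right_id ell1_one ell1_mul.
Proof.
move=> f; apply: ell1_eq => x; rewrite /= /conv (@csum_single _ _ x) /delta1.
  by rewrite mulVg eqxx mulr1.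
move=> y yx; case: eqP => [yx1|_]; last by rewrite mulr0.
by case/eqP: yx; rewrite -[RHS](mulVKg y) yx1 mulg1.
Qed.

Lemma ell1_mulDl : left_distributive ell1_mul +%R.
Proof.
move=> f g h; apply: ell1_eq => x; rewrite /= /conv /=.
rewrite -[RHS]csumD; [|exact: conv_summand..].
by congr csum; apply/funext => y; rewrite mulrDl.
Qed.

Lemma ell1_mulDr : right_distributive ell1_mul +%R.
Proof.
move=> f g h; apply: ell1_eq => x; rewrite /= /conv /=.
rewrite -[RHS]csumD; [|exact: conv_summand..].
by congr csum; apply/funext => y; rewrite mulrDr.
Qed.

Lemma ell1_one_neq0 : ell1_one != 0.
Proof.
apply/eqP => /(congr1 (fun f : ell1 => f 1%g)) /=.
by rewrite /delta1 eqxx => /eqP; rewrite oner_eq0.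
Qed.

HB.instance Definition _ := GRing.Zmodule_isNzRing.Build ell1
  ell1_mulA ell1_mul1f ell1_mulf1 ell1_mulDl ell1_mulDr ell1_one_neq0.

Lemma ell1_scalerAl (c : C) (f g : ell1) : c *: (f * g) = (c *: f) * g.
Proof.
apply: ell1_eq => x; rewrite /= /conv /=.
rewrite -[LHS]csumZ; last exact: conv_summand.
by congr csum; apply/funext => y; rewrite mulrA.
Qed.

Lemma ell1_scalerAr (c : C) (f g : ell1) : c *: (f * g) = f * (c *: g).
Proof.
apply: ell1_eq => x; rewrite /= /conv /=.
rewrite -[LHS]csumZ; last exact: conv_summand.
by congr csum; apply/funext => y; rewrite mulrCA.
Qed.

HB.instance Definition _ := GRing.Lmodule_isLalgebra.Build C ell1 ell1_scalerAl.
HB.instance Definition _ := GRing.Lalgebra_isAlgebra.Build C ell1 ell1_scalerAr.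

Lemma ell1_starD : {morph ell1_star : f g / f + g}.
Proof. by move=> f g; apply: ell1_eq => x /=; rewrite rmorphD. Qed.

Lemma ell1_starZ (c : C) (f : ell1) :
  ell1_star (c *: f) = Num.conj c *: ell1_star f.
Proof. by apply: ell1_eq => x /=; rewrite rmorphM. Qed.

Lemma ell1_starM (f g : ell1) : ell1_star (f * g) = ell1_star g * ell1_star f.
Proof.
apply: ell1_eq => x; rewrite /= /conv /= -csum_conj; last exact: conv_summand.
rewrite (csum_reindex _ (mulg_bij x^-1%g)); congr csum; apply/funext => y.
by rewrite rmorphM mulrC !invgM !invgK mulgK.
Qed.

Lemma ell1_starK : involutive ell1_star.
Proof. by move=> f; apply: ell1_eq => x /=; rewrite invgK conjCK. Qed.

HB.instance Definition _ := isStarAlgebra.Build R ell1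
  ell1_starD ell1_starZ ell1_starM ell1_starK.

End Ell1.

(* The library has no structure joining a ring with a normed module and its
   hierarchy cannot be extended from outside with one, so the multiplicative
   part is carried by explicit fields and turned into a star-algebra below. *)
Record cstarAlgebra (R : realType) := CstarAlgebra {
  cstar_space : completeNormedModType R[i] ;
  cstar_one : cstar_space ;
  cstar_mul : cstar_space -> cstar_space -> cstar_space ;
  cstar_star : cstar_space -> cstar_space ;
  cstar_mulA : associative cstar_mul ;
  cstar_mul1x : left_id cstar_one cstar_mul ;
  cstar_mulx1 : right_id cstar_one cstar_mul ;
  cstar_mulDl : left_distributive cstar_mul +%R ;
  cstar_mulDr : right_distributive cstar_mul +%R ;
  cstar_scaleAl : forall (c : R[i]) x y,
    c *: cstar_mul x y = cstar_mul (c *: x) y ;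
  cstar_scaleAr : forall (c : R[i]) x y,
    c *: cstar_mul x y = cstar_mul x (c *: y) ;
  cstar_one_neq0 : cstar_one != 0 ;
  cstar_starD : {morph cstar_star : x y / x + y} ;
  cstar_starZ : forall (c : R[i]) x,
    cstar_star (c *: x) = Num.conj c *: cstar_star x ;
  cstar_starM : forall x y,
    cstar_star (cstar_mul x y) = cstar_mul (cstar_star y) (cstar_star x) ;
  cstar_starK : involutive cstar_star ;
  cstar_normM : forall x y, `|cstar_mul x y| <= `|x| * `|y| ;
  cstar_normE : forall x, `|cstar_mul (cstar_star x) x| = `|x| ^+ 2 }.

Definition cstar_elt (R : realType) (A : cstarAlgebra R) : Type :=
  cstar_space A.
Coercion cstar_elt : cstarAlgebra >-> Sortclass.

Section CstarInstances.
Variables (R : realType) (A : cstarAlgebra R).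

HB.instance Definition _ :=
  CompleteNormedModule.copy (cstar_elt A) (cstar_space A).
HB.instance Definition _ := GRing.Zmodule_isNzRing.Build (cstar_elt A)
  (@cstar_mulA R A) (@cstar_mul1x R A) (@cstar_mulx1 R A)
  (@cstar_mulDl R A) (@cstar_mulDr R A) (@cstar_one_neq0 R A).
HB.instance Definition _ := GRing.Lmodule_isLalgebra.Build R[i] (cstar_elt A)
  (@cstar_scaleAl R A).
HB.instance Definition _ := GRing.Lalgebra_isAlgebra.Build R[i] (cstar_elt A)
  (@cstar_scaleAr R A).
HB.instance Definition _ := isStarAlgebra.Build R (cstar_elt A)
  (@cstar_starD R A) (@cstar_starZ R A) (@cstar_starM R A) (@cstar_starK R A).

End CstarInstances.

(* [inner] is linear in its first argument. *)
Record hilbertSpace (R : realType) := HilbertSpace {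
  hilbert_space :> completeNormedModType R[i] ;
  inner : {dot hilbert_space for (@Num.conj R[i])} ;
  hilbert_normE : forall u : hilbert_space, `|u| ^+ 2 = inner u u }.

Section Representations.
Variables (R : realType) (B : starAlgType R).

Record starRep (H : hilbertSpace R) := StarRep {
  rep :> B -> H -> H ;
  rep_linear : forall b, linear (rep b) ;
  rep_bounded : forall b, continuous (rep b) ;
  repD : forall a b u, rep (a + b) u = rep a u + rep b u ;
  repZ : forall (c : R[i]) b u, rep (c *: b) u = c *: rep b u ;
  repM : forall a b u, rep (a * b) u = rep a (rep b u) ;
  rep_star : forall b u v, inner H (rep b u) v = inner H u (rep (star b) v) }.

Definition rep_ker (H : hilbertSpace R) (pi : starRep H) : set B :=
  [set b | forall u, pi b u = 0].

Definition linear_subspace (H : hilbertSpace R) (V : set H) : Prop :=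
  V 0 /\ forall (c : R[i]) u v, V u -> V v -> V (c *: u + v).

Definition rep_invariant (H : hilbertSpace R) (pi : starRep H) (V : set H) : Prop :=
  forall b u, V u -> V (pi b u).

(* The zero representation on a one-dimensional space is not irreducible. *)
Definition irreducible (H : hilbertSpace R) (pi : starRep H) : Prop :=
  (exists b u, pi b u <> 0) /\
  forall V : set H, linear_subspace V -> closed V -> rep_invariant pi V ->
    V = [set 0] \/ V = [set: H].

Definition opnorm (H : hilbertSpace R) (T : H -> H) : \bar R :=
  ereal_sup [set (rnorm (T u))%:E | u in [set u : H | `|u| <= 1]].

Definition universal_norm (b : B) : \bar R :=
  ereal_sup [set r | exists (H : hilbertSpace R) (pi : starRep H),
                       r = opnorm (pi b)].

(* Hausdorff completion of [B] for [universal_norm], up to isomorphism *)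
Definition enveloping_cstar (A : cstarAlgebra R) (iota : {lrmorphism B -> A})
    : Prop :=
  [/\ forall b, iota (star b) = star (iota b),
      forall b, (rnorm (iota b))%:E = universal_norm b
    & dense (range iota)].

End Representations.

Definition group_cstar (R : realType) (G : groupType) (A : cstarAlgebra R)
    (iota : {lrmorphism ell1 R G -> A}) : Prop :=
  enveloping_cstar iota.

Section Ideals.
Variables (R : realType) (A : cstarAlgebra R).

Record closedIdeal := ClosedIdeal {
  ideal_set :> set A ;
  ideal0 : ideal_set 0 ;
  idealB : forall x y, ideal_set x -> ideal_set y -> ideal_set (x - y) ;
  idealMl : forall a x, ideal_set x -> ideal_set (a * x) ;
  idealMr : forall a x, ideal_set x -> ideal_set (x * a) ;
  ideal_closed : closed ideal_set }.

Definition Prim : set closedIdeal :=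
  [set J | exists (H : hilbertSpace R) (pi : starRep A H),
             irreducible pi /\ ideal_set J = rep_ker pi].

Section Quotient.
Variable J : closedIdeal.

Definition ideal_pred : {pred A} := fun x => `[< ideal_set J x >].

Lemma ideal_zmod_closed : zmod_closed ideal_pred.
Proof.
split; first exact/asboolP/ideal0.
by move=> x y /asboolP Jx /asboolP Jy; exact/asboolP/idealB.
Qed.

HB.instance Definition _ := GRing.isZmodClosed.Build A ideal_pred
  ideal_zmod_closed.

Definition cstar_quot : Type := Quotient.quot ideal_pred.

HB.instance Definition _ := GRing.Zmodule.on cstar_quot.

Definition Phi (a : A) : cstar_quot := \pi_(Quotient.quot ideal_pred) a.

Lemma Phi_eqP (a b : A) : Phi a = Phi b <-> ideal_set J (a - b).
Proof.
split; last by move=> Jab; apply/eqP; rewrite -Quotient.idealrBE; exact/asboolP.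
by move/eqP; rewrite -Quotient.idealrBE => /asboolP.
Qed.

Definition quot_repr (x : cstar_quot) : A := repr (x : Quotient.quot ideal_pred).

Lemma quot_reprK : cancel quot_repr Phi.
Proof. by move=> x; rewrite /Phi reprK. Qed.

Definition quot_mul (x y : cstar_quot) : cstar_quot :=
  Phi (quot_repr x * quot_repr y).

Lemma Phi_mul (a b : A) : Phi (a * b) = quot_mul (Phi a) (Phi b).
Proof.
apply/Phi_eqP.
set a' := quot_repr _; set b' := quot_repr _.
have Ja : ideal_set J (a - a') by apply/Phi_eqP; rewrite quot_reprK.
have Jb : ideal_set J (b' - b) by apply/Phi_eqP; rewrite quot_reprK.
have -> : a * b - a' * b' = (a - a') * b - a' * (b' - b).
  by rewrite mulrBl mulrBr opprB addrA subrK.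
by apply: idealB; [exact: idealMr|exact: idealMl].
Qed.

Lemma Phi_add (a b : A) : Phi (a + b) = Phi a + Phi b.
Proof. exact: raddfD. Qed.

Lemma quot_mulA : associative quot_mul.
Proof.
move=> x y z; rewrite -[x]quot_reprK -[y]quot_reprK -[z]quot_reprK.
by rewrite -!Phi_mul mulrA.
Qed.

Lemma quot_mul1x : left_id (Phi 1) quot_mul.
Proof. by move=> x; rewrite -[x]quot_reprK -Phi_mul mul1r. Qed.

Lemma quot_mulx1 : right_id (Phi 1) quot_mul.
Proof. by move=> x; rewrite -[x]quot_reprK -Phi_mul mulr1. Qed.

Lemma quot_mulDl : left_distributive quot_mul +%R.
Proof.
move=> x y z; rewrite -[x]quot_reprK -[y]quot_reprK -[z]quot_reprK.
by rewrite -Phi_add -!Phi_mul -Phi_add mulrDl.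
Qed.

Lemma quot_mulDr : right_distributive quot_mul +%R.
Proof.
move=> x y z; rewrite -[x]quot_reprK -[y]quot_reprK -[z]quot_reprK.
by rewrite -Phi_add -!Phi_mul -Phi_add mulrDr.
Qed.

HB.instance Definition _ := GRing.Zmodule_isPzRing.Build cstar_quot
  quot_mulA quot_mul1x quot_mulx1 quot_mulDl quot_mulDr.

Lemma Phi_is_zmod_morphism : zmod_morphism Phi.
Proof. exact: raddfB. Qed.

Lemma Phi_is_monoid_morphism : monoid_morphism Phi.
Proof. by split=> // a b; exact: Phi_mul. Qed.

HB.instance Definition _ := GRing.isZmodMorphism.Build A cstar_quot Phi
  Phi_is_zmod_morphism.
HB.instance Definition _ := GRing.isMonoidMorphism.Build A cstar_quot Phi
  Phi_is_monoid_morphism.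

End Quotient.
End Ideals.

Arguments closedIdeal {R} A.
Arguments Prim {R} A.

Definition invertible (S : pzRingType) (x : S) : Prop :=
  exists y, x * y = 1 /\ y * x = 1.

Fixpoint upper_central (G : groupType) (n : nat) : set G :=
  if n is m.+1 then [set x | forall y, upper_central m [~ x, y]%g]
  else [set 1%g].
Arguments upper_central : clear implicits.

Definition nilpotent_group (G : groupType) : Prop :=
  exists n, upper_central G n = [set: G].

(* Main.v *)
From HB Require Import structures.
Require Import Defs.
From mathcomp Require Import all_boot all_order all_algebra.
From mathcomp Require Import sesquilinear complex.
From mathcomp Require Import all_classical all_reals all_analysis.
From mathcomp Require Import ring lra.

(** The theorem holds in any unital C*-algebra [A]. If [a] is not invertible then,
    up to replacing it by its adjoint, [star a * a] is not invertible. Among the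
    states of [A] those vanishing at [star a * a] form a nonempty face (nonempty
    because the distance from [star a * a] to a scalar [t >= 0] is at least [t]),
    and an extreme point of that face is a pure state. Its GNS representation is
    irreducible and [a] kills the cyclic vector, so [a] has no left inverse modulo
    the kernel, which is a primitive ideal. That states are nonnegative on
    [star x * x] is read off the universal norm: in each representation of
    [ell1], [|| c^2 - T^* T || <= c^2] when [||T|| <= c]. *)

Set Implicit Arguments.
Unset Strict Implicit.
Unset Printing Implicit Defensive.

Import Order.TTheory GRing.Theory Num.Theory.
Import numFieldNormedType.Exports.

Local Open Scope classical_set_scope.
Local Open Scope complex_scope.
Local Open Scope ring_scope.

(** * Real-valued norms and convergence at a definite rate *)

(** Two classical tools are avoided. The first is functional calculus: with no square roots in [A],
    the bound of the GNS operators cannot come from writing [rnorm x ^+ 2 - star x * x] as a square,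
    and iterated Cauchy-Schwarz inequalities replace it; the only spectral input is the Neumann
    series. The second is weak-star compactness: a face of the state space is encoded by a sublinear
    function, its support function, and Zorn's lemma runs on these functions, so that a minimal one
    is itself the extreme functional. Left and right inverses are treated separately: [star a * a]
    yields the former, [a * star a] the latter. *)

Section RealNorm.
Variable R : realType.

Section Zmod.
Variable V : normedZmodType R[i].
Implicit Types x y : V.

Lemma normr_rnorm x : `|x| = (rnorm x)%:C.
Proof. by rewrite /rnorm RRe_real// normr_real. Qed.

Lemma rnorm_le_normr x (r : R) : (rnorm x <= r) = (`|x| <= r%:C).
Proof. by rewrite normr_rnorm lecR. Qed.

Lemma rnorm_lt_normr x (r : R) : (rnorm x < r) = (`|x| < r%:C).
Proof. by rewrite normr_rnorm ltcR. Qed.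

Lemma rnormv_ge0 x : 0 <= rnorm x.
Proof. by rewrite -ler0c -normr_rnorm. Qed.

Lemma rnormv0 : rnorm (0 : V) = 0.
Proof. by rewrite /rnorm normr0. Qed.

Lemma rnormv_eq0 x : rnorm x = 0 -> x = 0.
Proof. by move=> x0; apply: normr0_eq0; rewrite normr_rnorm x0. Qed.

Lemma rnormvN x : rnorm (- x) = rnorm x.
Proof. by rewrite /rnorm normrN. Qed.

Lemma rnormvC x y : rnorm (x - y) = rnorm (y - x).
Proof. by rewrite /rnorm distrC. Qed.

Lemma rnormvD x y : rnorm (x + y) <= rnorm x + rnorm y.
Proof. by rewrite rnorm_le_normr rmorphD /= -!normr_rnorm ler_normD. Qed.

Lemma rnormvB x y : rnorm (x - y) <= rnorm x + rnorm y.
Proof. by rewrite -(rnormvN y) rnormvD. Qed.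

Lemma rnormv_dist z x y : rnorm (x - y) <= rnorm (x - z) + rnorm (z - y).
Proof. by rewrite -{1}(subrK z x) -addrA rnormvD. Qed.

End Zmod.

Lemma rnorm_real (r : R) : rnorm (r%:C : R[i]) = `|r|.
Proof. by rewrite rnorm_normc /= expr0n addr0 sqrtr_sqr. Qed.

Lemma rnormZ (V : normedModType R[i]) (c : R[i]) (x : V) :
  rnorm (c *: x) = rnorm c * rnorm x.
Proof. by rewrite /rnorm normrZ (normr_rnorm c) (normr_rnorm x) -rmorphM. Qed.

End RealNorm.

(* Convergence is tracked through explicit rates [c / (n + 1)], so that limits
   in the completion need no topology. *)
Definition rate (R : realType) (n : nat) : R := n.+1%:R^-1.

Section Rates.
Variable R : realType.

Lemma rate_gt0 n : 0 < rate R n. Proof. by rewrite invr_gt0. Qed.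

Lemma rate_le1 n : rate R n <= 1. Proof. by rewrite invf_le1// ler1n. Qed.

Definition rate_cauchy (V : normedZmodType R[i]) (x : nat -> V) :=
  exists c : R, forall n m, rnorm (x n - x m) <= c * rate R n + c * rate R m.

Definition rate_cvg (V : normedZmodType R[i]) (x : nat -> V) (l : V) :=
  exists c : R, forall n, rnorm (l - x n) <= c * rate R n.

Lemma rate_lt (c e : R) : 0 < e ->
  exists N, forall n, (N <= n)%N -> c * rate R n < e.
Proof.
move=> e0; have [N cN] : exists N : nat, c / e < N%:R.
  exists (Num.Def.archi_bound `|c / e|).
  by apply: le_lt_trans (ler_norm _) _; rewrite archi_boundP.
exists N => n Nn; rewrite /rate ltr_pdivrMr// -ltr_pdivrMl// mulrC.
by apply: lt_le_trans cN _; rewrite ler_nat leqW.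
Qed.

Lemma ler_rate (a b c : R) : (forall n, a <= b + c * rate R n) -> a <= b.
Proof.
move=> h; apply/ler_addgt0Pl => e e0; have [N /(_ N (leqnn N)) ce] := rate_lt c e0.
by apply: le_trans (h N) _; rewrite addrC lerD2r ltW.
Qed.

Lemma rate_le (c : R) n : 0 <= c -> c * rate R n <= c.
Proof.
by move=> c0; rewrite ler_piMr// rate_le1.
Qed.

Lemma rate_cvg_unique (V : normedZmodType R[i]) (x : nat -> V) l l' :
  rate_cvg x l -> rate_cvg x l' -> l = l'.
Proof.
move=> [c cl] [c' cl']; apply/eqP; rewrite -subr_eq0; apply/eqP/rnormv_eq0.
apply/eqP; rewrite eq_le rnormv_ge0 andbT; apply: (@ler_rate _ _ (c + c')) => n.
rewrite add0r mulrDl; apply: le_trans (rnormv_dist (x n) _ _) _.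
by rewrite lerD// rnormvC.
Qed.

Lemma rate_cvg_near (V : normedModType R[i]) (x : nat -> V) (l : V) :
  rate_cvg x l -> x n @[n --> \oo] --> l.
Proof.
move=> [c cl]; apply/cvgrPdist_le => e e0.
have er : e \is Num.real by apply: gtr0_real.
have [N hN] : exists N, forall n, (N <= n)%N -> c * rate R n < complex.Re e.
  by apply: rate_lt; rewrite -ltcR RRe_real.
exists N => // n /= Nn; rewrite -(RRe_real er) -rnorm_le_normr.
exact: le_trans (cl n) (ltW (hN n Nn)).
Qed.

Lemma rate_cvg_closed (V : normedModType R[i]) (E : set V) (x : nat -> V) l :
  closed E -> (forall n, E (x n)) -> rate_cvg x l -> E l.
Proof.
move=> cE Ex /rate_cvg_near; apply: closed_cvg => //.
by exists 0%N.
Qed.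

Lemma rate_cauchy_cvg (V : completeNormedModType R[i]) (x : nat -> V) :
  rate_cauchy x -> exists l, rate_cvg x l.
Proof.
move=> [c xc]; have c0 : 0 <= c + c.
  by have := le_trans (rnormv_ge0 _) (xc 0%N 0%N); rewrite /rate invr1 !mulr1.
have Cx : cauchy (x n @[n --> \oo]).
  apply: cauchy_exP => e e0.
  have er : e \is Num.real by apply: gtr0_real.
  have e2 : 0 < complex.Re e / 2 by rewrite divr_gt0// -ltcR RRe_real.
  have [N hN] := rate_lt c e2.
  exists (x N), N => // n /= Nn; rewrite -ball_normE /= -(RRe_real er) -rnorm_lt_normr.
  apply: le_lt_trans (xc N n) _; rewrite [ltRHS](splitr (complex.Re e)).
  by rewrite ltrD// hN.
have /cvg_ex[l xl] : cvg (x n @[n --> \oo]) by exact: cauchy_cvg.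
(* The topological limit carries no rate; the rate, with the same [c], comes from comparing [x n]
   with [x m] for large [m]. *)
exists l, c => n; apply/ler_addgt0Pl => e e0.
have e2 : 0 < e / 2 by rewrite divr_gt0.
have [N hN] := rate_lt c e2.
have e2C : 0 < (e / 2)%:C by rewrite -[0]/(0%:C) ltcR.
move/cvgrPdist_le : xl => /(_ _ e2C)[M _ hM].
pose m := maxn N M.
apply: le_trans (rnormv_dist (x m) _ _) _.
have h1 : rnorm (l - x m) <= e / 2.
  by rewrite rnorm_le_normr; apply: hM; rewrite /= leq_maxr.
have := xc m n; have := hN m (leq_maxl _ _); lra.
Qed.

Lemma lipschitz_continuous_rnorm (V W : normedModType R[i]) (T : V -> W) (c : R) :
  (forall u v, rnorm (T u - T v) <= c * rnorm (u - v)) -> continuous T.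
Proof.
move=> hT u; apply/cvgrPdist_le => e e0.
have er : e \is Num.real by apply: gtr0_real.
have e1 : 0 < complex.Re e by rewrite -ltcR RRe_real.
have c1 : 0 < `|c| + 1 by rewrite ltr_wpDl.
have d0 : 0 < (complex.Re e / (`|c| + 1))%:C by rewrite -[0]/(0%:C) ltcR divr_gt0.
apply: filterS (nbhsx_ballx u _ d0) => v; rewrite -ball_normE /= -rnorm_lt_normr => uv.
rewrite -(RRe_real er) -rnorm_le_normr; apply: le_trans (hT _ _) _.
apply: (@le_trans _ _ ((`|c| + 1) * rnorm (u - v))).
  rewrite ler_wpM2r ?rnormv_ge0//; apply: le_trans (ler_norm c) _.
  by rewrite lerDl.
by rewrite mulrC -ler_pdivlMr// ltW.
Qed.

(** A Cauchy filter contains a ball of radius [rate R n] for every [n]. Any two of these balls meet,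
    so their centres form a rate-Cauchy sequence, and its limit is the limit of the filter. *)
Lemma rate_complete (V : normedModType R[i]) :
  (forall x : nat -> V, rate_cauchy x -> exists l, rate_cvg x l) ->
  forall F : set_system V, ProperFilter F -> cauchy F -> cvg F.
Proof.
move=> hV F FF /cauchyP Fc.
have eps_gt0 n : 0 < (rate R n)%:C by rewrite -[0]/(0%:C) ltcR rate_gt0.
have [x Fx] := choice (fun n => Fc _ (eps_gt0 n)).
have [|l [c xl]] := hV x.
  exists 1 => n m; have [z []] := filter_ex (filterI (Fx n) (Fx m)).
  rewrite -!ball_normE /= -!rnorm_lt_normr => nz mz.
  by apply: le_trans (rnormv_dist z _ _) _; rewrite !mul1r lerD// ltW// rnormvC.
apply/cvg_ex; exists l; apply/cvgrPdist_le => e e0.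
have er : e \is Num.real by apply: gtr0_real.
have e1 : 0 < complex.Re e by rewrite -ltcR RRe_real.
have [N /(_ N (leqnn N)) hN] := rate_lt (c + 1) e1.
apply: filterS (Fx N) => z; rewrite -ball_normE /= -rnorm_lt_normr => Nz.
rewrite -(RRe_real er) -rnorm_le_normr.
apply: le_trans (rnormv_dist (x N) _ _) _; apply: le_trans (ltW hN).
by rewrite mulrDl lerD// mul1r ltW.
Qed.

(** The intervals of radius [c * rate R n] around [x n] meet pairwise; the supremum of their left
    ends lies in all of them, so the constant is kept. *)
Lemma real_rate_complete (x : nat -> R) c :
  (forall n m, `|x n - x m| <= c * rate R n + c * rate R m) ->
  exists l, forall n, `|l - x n| <= c * rate R n.
Proof.
move=> xc; pose E := range (fun n => x n - c * rate R n).
have ubE m : ubound E (x m + c * rate R m).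
  by move=> _ [n _ <-]; have := xc n m; rewrite ler_norml => /andP[_]; lra.
have E0 : E !=set0 by exists (x 0%N - c / 1%:R), 0%N.
exists (sup E) => n; rewrite ler_distl; apply/andP; split.
  apply: ub_le_sup; last by exists n.
  by exists (x 0%N + c / 1%:R); exact: ubE.
by apply: ge_sup => //; exact: ubE.
Qed.

Lemma complex_rate_complete (z : nat -> R[i]) :
  rate_cauchy z -> exists l, rate_cvg z l.
Proof.
move=> [c zc].
have [|a za] := @real_rate_complete (fun n => complex.Re (z n)) c.
  by move=> n m; rewrite -raddfB; apply: le_trans (Re_le_rnorm _) (zc n m).
have [|b zb] := @real_rate_complete (fun n => complex.Im (z n)) c.
  by move=> n m; rewrite -raddfB; apply: le_trans (Im_le_rnorm _) (zc n m).
exists (a +i* b), (c + c) => n; rewrite mulrDl.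
apply: le_trans (rnorm_le_ReIm _) _; rewrite !raddfB/=.
exact: lerD.
Qed.

Lemma rate_cvgD (V : normedZmodType R[i]) (x y : nat -> V) l l' :
  rate_cvg x l -> rate_cvg y l' -> rate_cvg (fun n => x n + y n) (l + l').
Proof.
move=> [c cl] [c' cl']; exists (c + c') => n.
by rewrite opprD addrACA mulrDl; apply: le_trans (rnormvD _ _) (lerD _ _).
Qed.

Lemma rate_cvgM (z : nat -> R[i]) l (a : R[i]) :
  rate_cvg z l -> rate_cvg (fun n => a * z n) (a * l).
Proof.
move=> [c cl]; exists (rnorm a * c) => n.
by rewrite -mulrBr rnormM -mulrA ler_wpM2l// rnorm_ge0.
Qed.

Lemma rate_cvg_conj (z : nat -> R[i]) l :
  rate_cvg z l -> rate_cvg (fun n => (z n)^*) l^*.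
Proof. by move=> [c cl]; exists c => n; rewrite -rmorphB rnorm_conj. Qed.

Lemma rate_cvg_Re_le (z : nat -> R[i]) l (a b : R) : rate_cvg z l ->
  (forall n, complex.Re (z n) <= a + b * rate R n) -> complex.Re l <= a.
Proof.
move=> [c cl] zab; apply: (@ler_rate _ _ (b + c)) => n.
have := le_trans (ler_norm _) (le_trans (Re_le_rnorm _) (cl n)).
by have := zab n; rewrite raddfB mulrDl /=; lra.
Qed.

Lemma rate_cvg_Re_ge (z : nat -> R[i]) l (a : R) : rate_cvg z l ->
  (forall n, a <= complex.Re (z n)) -> a <= complex.Re l.
Proof.
move=> [c cl] za; apply: (@ler_rate _ _ c) => n.
have := le_trans (Re_le_rnorm _) (cl n); rewrite raddfB ler_norml /= => /andP[+ _].
by have := za n; lra.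
Qed.

End Rates.

(** * Extreme functionals below a sublinear function *)

Section ExtremeFunctional.
Variables (R : realType) (V : lmodType R).
Implicit Types (p q : V -> R) (f : V -> R) (x y : V) (r t : R).

Lemma scalar_opp f x : scalar f -> f (- x) = - f x.
Proof.
move=> lf; have := lf (-1) x 0; have := lf 1 0 0.
by rewrite scaleN1r scaler0 !addr0 mulN1r mul1r; lra.
Qed.

(** One inequality for [0 < r] is enough: scaling back by [r^-1] gives the other, and [r = 2],
    [r = 2^-1] force [q 0 = 0]. *)
Definition sublinear q :=
  (forall x y, q (x + y) <= q x + q y) /\
  (forall r x, 0 < r -> q (r *: x) <= r * q x).

Lemma sublinear0 q : sublinear q -> q 0 = 0.
Proof.
move=> [_ qZ]; have h1 := qZ 2 0 (ltr0Sn _ _).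
have h2 : q (2^-1 *: 0) <= 2^-1 * q 0 by apply: qZ; rewrite invr_gt0.
by rewrite !scaler0 in h1 h2; lra.
Qed.

Lemma sublinearZ q r x : sublinear q -> 0 <= r -> q (r *: x) = r * q x.
Proof.
move=> sq; rewrite le_eqVlt => /predU1P[<-|r0].
  by rewrite scale0r mul0r sublinear0.
apply/eqP; rewrite eq_le (sq.2 _ _ r0)/= -ler_pdivlMl//.
rewrite -{1}(scalerK (lt0r_neq0 r0) x); apply: sq.2.
by rewrite invr_gt0.
Qed.

Lemma sublinearN_ge q x : sublinear q -> - q (- x) <= q x.
Proof. by move=> sq; have := sq.1 x (- x); rewrite subrr sublinear0//; lra. Qed.

Lemma sublinear_scalar q : sublinear q -> (forall x, q (- x) <= - q x) -> scalar q.
Proof.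
move=> sq qN; have qNE x : q (- x) = - q x.
  by have := qN x; have := sublinearN_ge x sq; lra.
have qD x y : q (x + y) = q x + q y.
  by have := sq.1 x y; have := sq.1 (- x) (- y); rewrite -opprD !qNE; lra.
move=> r x y; rewrite qD; congr (_ + _).
have [r0|/ltW r0] := leP 0 r; first exact: sublinearZ.
by rewrite -[r]opprK scaleNr qNE sublinearZ ?oppr_ge0// opprK mulNr opprK.
Qed.

(* A sublinear [q] stands for the set of linear functionals below it; the
   functionals below [q] then form a face of those below [p]. *)
Definition face p q := forall t f1 f2, 0 < t < 1 -> scalar f1 -> scalar f2 ->
  (forall x, f1 x <= p x) -> (forall x, f2 x <= p x) ->
  (forall x, t * f1 x + (1 - t) * f2 x <= q x) -> forall x, f1 x <= q x.

(* The face of the functionals below [q] that take the value [q y] at [y]. *)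
Definition support_face q y x := inf [set q (x + t *: y) - t * q y | t in [set t | 0 <= t]].

Section SupportFace.
Variables (q : V -> R) (y : V).
Hypothesis sq : sublinear q.

Lemma support_face_lb x :
  has_lbound [set q (x + t *: y) - t * q y | t in [set t | 0 <= t]].
Proof.
exists (- q (- x)) => _ [t /= t0 <-].
have := sq.1 (- x) (x + t *: y); rewrite addKr sublinearZ//; lra.
Qed.

Lemma support_face_le t x : 0 <= t -> support_face q y x <= q (x + t *: y) - t * q y.
Proof. by move=> t0; apply: ge_inf; [exact: support_face_lb|exists t]. Qed.

Lemma le_support_face r x : (forall t, 0 <= t -> r <= q (x + t *: y) - t * q y) ->
  r <= support_face q y x.
Proof.
move=> h; apply: lb_le_inf; first by exists (q (x + 0 *: y) - 0 * q y), 0 => /=.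
by move=> _ [t /= t0 <-]; exact: h.
Qed.

Lemma support_face_self x : support_face q y x <= q x.
Proof. by have := support_face_le x (lexx 0); rewrite scale0r addr0 mul0r subr0. Qed.

Lemma support_faceN : support_face q y (- y) <= - q y.
Proof.
by have := support_face_le (- y) ler01; rewrite scale1r addNr sublinear0// mul1r sub0r.
Qed.

Lemma sublinear_support_face : sublinear (support_face q y).
Proof.
split=> [x z|r x r0].
  rewrite -lerBlDl; apply: le_support_face => t t0; rewrite lerBlDl -lerBlDr.
  apply: le_support_face => s s0; rewrite lerBlDr.
  apply: le_trans (support_face_le _ (addr_ge0 s0 t0)) _.
  by have := sq.1 (x + s *: y) (z + t *: y); rewrite addrACA -scalerDl; lra.
rewrite -ler_pdivrMl//; apply: le_support_face => t t0; rewrite ler_pdivrMl//.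
have rt0 : 0 <= r * t by rewrite mulr_ge0// ltW.
apply: le_trans (support_face_le _ rt0) _.
by rewrite -scalerA -scalerDr sublinearZ ?(ltW r0)// mulrBr mulrA.
Qed.

Lemma face_support_face p : face p q -> (forall x, q x <= p x) ->
  face p (support_face q y).
Proof.
move=> fq qp t f1 f2 t01 lf1 lf2 f1p f2p fle.
have /andP[t0 t1] := t01.
have fleq x : t * f1 x + (1 - t) * f2 x <= q x.
  exact: le_trans (fle x) (support_face_self x).
have f1q := fq _ _ _ t01 lf1 lf2 f1p f2p fleq.
have f2q : forall x, f2 x <= q x.
  apply: (fq (1 - t) f2 f1) => //; first by apply/andP; split; lra.
  by move=> x; rewrite subKr addrC.
(* At [- y] the convex combination is at most [- q y], so at [y] it is at least [q y], while both
   functionals are at most [q y] there: both are equal to it. *)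
have f1y : f1 y = q y.
  have := le_trans (fle (- y)) support_faceN; rewrite !scalar_opp// => h.
  by have := f1q y; have := f2q y; nra.
move=> x; apply: le_support_face => s s0.
by have := f1q (x + s *: y); rewrite addrC lf1 f1y addrC; lra.
Qed.

End SupportFace.

(* Minimal elements among the sublinear functions describing a face are linear:
   otherwise [support_face] would be smaller. *)
Theorem extreme_scalar_below p q0 : sublinear p -> sublinear q0 ->
  (forall x, q0 x <= p x) -> face p q0 ->
  exists f, [/\ scalar f, forall x, f x <= q0 x &
    forall t f1 f2, 0 < t < 1 -> scalar f1 -> scalar f2 ->
      (forall x, f1 x <= p x) -> (forall x, f2 x <= p x) ->
      (forall x, f x = t * f1 x + (1 - t) * f2 x) -> f1 = f].
Proof.
move=> sp sq0 q0p fq0.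
pose good q := [/\ sublinear q, forall x, q x <= q0 x & face p q].
pose T := {q | good q}.
(* The order is reversed, so that a maximal element is a pointwise minimal function and chains are
   bounded by their infimum. *)
pose R' (q1 q2 : T) := `[< forall x, sval q2 x <= sval q1 x >].
have goodq0 : good q0 by split.
have [|||[q [sq qq0 fq]] qmin] := @ZL_preorder T (exist _ q0 goodq0) R'.
- by move=> q; apply/asboolP.
- move=> q1 q2 q3 /asboolP h12 /asboolP h23; apply/asboolP => x.
  exact: le_trans (h23 x) (h12 x).
- move=> S Stot.
  have [[s0 Ss0]|S0] := pselect (S !=set0); last first.
    exists (exist _ q0 goodq0) => s Ss; exfalso; apply: S0; by exists s.
  pose E x := [set sval s x | s in S].
  have lbE x : has_lbound (E x).
    exists (- q0 (- x)) => _ [s Ss <-]; have [ss sq0' _] := svalP s.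
    by apply: le_trans (sublinearN_ge x ss); rewrite lerN2; exact: sq0'.
  pose m x := inf (E x).
  have mle (s : T) x : S s -> m x <= sval s x by move=> Ss; apply: ge_inf; [exact: lbE|exists s].
  have lem r x : (forall s : T, S s -> r <= sval s x) -> r <= m x.
    move=> h; apply: lb_le_inf; first by exists (sval s0 x), s0.
    by move=> _ [s Ss <-]; exact: h.
  have gm : good m.
    split; [split=> [x y|r x r0]| |].
    + rewrite -lerBlDl; apply: (lem) => s Ss; rewrite lerBlDl -lerBlDr.
      apply: lem => s' Ss'; rewrite lerBlDr.
      have [[sD _] _ _] := svalP s; have [[sD' _] _ _] := svalP s'.
      (* An infimum of subadditive functions need not be subadditive; in a chain, the smaller of [s]
         and [s'] serves for both summands. *)
      have [/asboolP h|/asboolP h] := Stot _ _ Ss Ss'.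
        by apply: le_trans (mle s' _ Ss') _; have := sD' x y; have := h y; lra.
      by apply: le_trans (mle s _ Ss) _; have := sD x y; have := h x; lra.
    + rewrite -ler_pdivrMl//; apply: lem => s Ss; rewrite ler_pdivrMl//.
      by have [[_ sZ] _ _] := svalP s; apply: le_trans (mle s _ Ss) (sZ _ _ r0).
    + move=> x; have [_ h _] := svalP s0.
      exact: le_trans (mle _ _ Ss0) (h x).
    + move=> t f1 f2 t01 lf1 lf2 f1p f2p h x; apply: lem => s Ss.
      have [_ _ fs] := svalP s; apply: (fs t f1 f2) => // z.
      exact: le_trans (h z) (mle _ _ Ss).
  by exists (exist _ m gm) => s Ss; apply/asboolP => x; exact: mle.
have qp x : q x <= p x by exact: le_trans (qq0 x) (q0p x).
have lq : scalar q.
  apply: sublinear_scalar => // y.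
  have gy : good (support_face q y).
    split; [exact: sublinear_support_face| |exact: face_support_face].
    by move=> x; apply: le_trans (support_face_self _ sq _) (qq0 x).
  have /(_ (- y)) h : forall x, q x <= support_face q y x.
    apply/asboolP; apply: (qmin (exist _ _ gy)).
    by apply/asboolP => x; exact: support_face_self.
  exact: le_trans h (support_faceN _ sq).
exists q; split=> // t f1 f2 t01 lf1 lf2 f1p f2p qE.
(* The face property puts [f1] below [q], and between linear functionals domination is equality, by
   evaluation at [- x]. *)
have f1q : forall x, f1 x <= q x by apply: (fq t f1 f2) => // x; rewrite qE.
apply/funext => x; apply/eqP; rewrite eq_le f1q/=.
by have := f1q (- x); rewrite !scalar_opp// lerN2.
Qed.

End ExtremeFunctional.

(** * Hilbert completion of a semi-inner product *)

Record psdForm (R : realType) (V : lmodType R[i]) := PsdForm {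
  psd :> V -> V -> R[i] ;
  psd_linear : forall a x y z, psd (a *: x + y) z = a * psd x z + psd y z ;
  psd_herm : forall x y, psd y x = (psd x y)^* ;
  psd_ge0 : forall x, 0 <= complex.Re (psd x x) }.

Section PsdForm.
Variables (R : realType) (V : lmodType R[i]) (B : psdForm V).
Implicit Types (x y z : V) (a : R[i]).

Lemma psdDl x y z : B (x + y) z = B x z + B y z.
Proof. by have := psd_linear B 1 x y z; rewrite scale1r mul1r. Qed.

Lemma psd0l z : B 0 z = 0.
Proof. by apply: (addrI (B 0 z)); rewrite -psdDl !addr0. Qed.

Lemma psdZl a x z : B (a *: x) z = a * B x z.
Proof. by have := psd_linear B a x 0 z; rewrite psd0l !addr0. Qed.

Lemma psdNl x z : B (- x) z = - B x z.
Proof. by rewrite -scaleN1r psdZl mulN1r. Qed.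

Lemma psdBl x y z : B (x - y) z = B x z - B y z.
Proof. by rewrite psdDl psdNl. Qed.

Lemma psdDr x y z : B x (y + z) = B x y + B x z.
Proof. by rewrite psd_herm psdDl rmorphD /= -!psd_herm. Qed.

Lemma psdZr a x y : B x (a *: y) = a^* * B x y.
Proof. by rewrite psd_herm psdZl rmorphM /= -psd_herm. Qed.

Lemma psdNr x y : B x (- y) = - B x y.
Proof. by rewrite psd_herm psdNl rmorphN /= -psd_herm. Qed.

Lemma psdBr x y z : B x (y - z) = B x y - B x z.
Proof. by rewrite psdDr psdNr. Qed.

Definition psdn x : R := Num.sqrt (complex.Re (B x x)).

Lemma psdn_ge0 x : 0 <= psdn x. Proof. exact: sqrtr_ge0. Qed.

Lemma psdn_sqr x : psdn x ^+ 2 = complex.Re (B x x).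
Proof. by rewrite sqr_sqrtr// psd_ge0. Qed.

Lemma psdE x : B x x = (psdn x ^+ 2)%:C.
Proof.
rewrite psdn_sqr; have := psd_herm B x x; case: (B x x) => r s /= [s0].
by apply/eqP; rewrite eq_complex eqxx /=; apply/eqP; lra.
Qed.

Lemma psdnE x r : 0 <= r -> complex.Re (B x x) = r ^+ 2 -> psdn x = r.
Proof. by move=> r0 h; rewrite /psdn h sqrtr_sqr ger0_norm. Qed.

Lemma complex_Re_conj a : complex.Re a^* = complex.Re a. Proof. by case: a. Qed.

Lemma psdn_sqrD x y :
  psdn (x + y) ^+ 2 = psdn x ^+ 2 + psdn y ^+ 2 + 2 * complex.Re (B x y).
Proof.
rewrite !psdn_sqr !psdDl !psdDr (psd_herm B x y) !raddfD /= complex_Re_conj.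
ring.
Qed.

Lemma psdnZ a x : psdn (a *: x) = rnorm a * psdn x.
Proof.
apply: psdnE; first by rewrite mulr_ge0 ?psdn_ge0 ?rnorm_ge0.
rewrite psdZl psdZr psdE mulrA -normCK normr_rnorm -rmorphXn -rmorphM /=.
by rewrite exprMn.
Qed.

Lemma psdnN x : psdn (- x) = psdn x.
Proof. by rewrite -scaleN1r psdnZ /rnorm normrN1 mul1r. Qed.

Lemma psdnC x y : psdn (x - y) = psdn (y - x).
Proof. by rewrite -opprB psdnN. Qed.

(** The factor [B x y] makes the cross term real, leaving a real quadratic in [s]. Its nonnegativity
    gives Cauchy-Schwarz, and minimality of a distance gives orthogonality. *)
Lemma psdn_sqr_subZ x y (s : R) :
  psdn (x - (s%:C * B x y) *: y) ^+ 2 =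
  psdn x ^+ 2 - 2 * s * rnorm (B x y) ^+ 2 + s ^+ 2 * rnorm (B x y) ^+ 2 * psdn y ^+ 2.
Proof.
rewrite psdn_sqrD psdnN psdnZ psdNr psdZr rmorphM /=.
rewrite -mulrA [_^* * B x y]mulrC -normCK.
rewrite [_^*]conjc_real normr_rnorm -rmorphXn -rmorphM -rmorphN/= rnormM rnorm_real.
by rewrite !exprMn real_normK ?num_real//; ring.
Qed.

Lemma psd_CauchySchwarz x y : rnorm (B x y) <= psdn x * psdn y.
Proof.
pose b := rnorm (B x y) ^+ 2.
have quad s : 0 <= psdn x ^+ 2 - 2 * s * b + s ^+ 2 * b * psdn y ^+ 2.
  by rewrite -psdn_sqr_subZ sqr_ge0.
have b0 : 0 <= b by exact: sqr_ge0.
suff : b <= (psdn x * psdn y) ^+ 2.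
  by rewrite ler_sqr// ?nnegrE ?mulr_ge0 ?psdn_ge0 ?rnorm_ge0.
(* The form may be degenerate. If [psdn y = 0] the quadratic is affine in [s], and the chosen [s]
   brings it to [-1]; otherwise [s = psdn y ^- 2] is its minimiser. *)
rewrite exprMn; have := sqr_ge0 (psdn y); rewrite le_eqVlt => /predU1P[y0|y0].
  rewrite -y0 mulr0 leNgt; apply/negP => bgt0.
  have := quad ((psdn x ^+ 2 + 1) / (2 * b)); rewrite -y0 mulr0 addr0.
  have -> : 2 * ((psdn x ^+ 2 + 1) / (2 * b)) * b = psdn x ^+ 2 + 1.
    by field; rewrite lt0r_neq0.
  lra.
have := quad (psdn y ^- 2).
have -> : 2 * psdn y ^- 2 * b = b / psdn y ^+ 2 + b / psdn y ^+ 2 by ring.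
have -> : (psdn y ^- 2) ^+ 2 * b * psdn y ^+ 2 = b / psdn y ^+ 2.
  by field; rewrite -sqrf_eq0 lt0r_neq0.
rewrite -ler_pdivrMr//; lra.
Qed.

Lemma psdnD x y : psdn (x + y) <= psdn x + psdn y.
Proof.
rewrite -ler_sqr ?nnegrE ?addr_ge0 ?psdn_ge0//.
rewrite psdn_sqrD sqrrD -addrA [leRHS]addrAC -[leRHS]addrA lerD2l lerD2l//.
rewrite -[leRHS]mulr_natl ler_wpM2l//.
exact: le_trans (ler_norm _) (le_trans (Re_le_rnorm _) (psd_CauchySchwarz _ _)).
Qed.

Lemma psdn_dist z x y : psdn (x - y) <= psdn (x - z) + psdn (z - y).
Proof. by rewrite -{1}(subrK z x) -addrA psdnD. Qed.

Lemma psd_parallelogram x y :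
  psdn (x + y) ^+ 2 + psdn (x - y) ^+ 2 = 2 * psdn x ^+ 2 + 2 * psdn y ^+ 2.
Proof. by rewrite !psdn_sqrD psdnN psdNr raddfN /=; ring. Qed.

End PsdForm.

(* The completion is realised inside the functions [V -> R[i]]: [x] in [V]
   becomes [B x], and a limit of such is a function that is approximated at a
   definite rate, uniformly with respect to the seminorm. *)
Section Completion.
Variables (R : realType) (V : lmodType R[i]) (B : psdForm V).
Implicit Types (x y z : V) (a : R[i]) (u v w : nat -> V).

Definition represents u (g : V -> R[i]) :=
  exists c : R, forall n y, rnorm (g y - B (u n) y) <= c * rate R n * psdn B y.

Definition hcompl_pred : {pred V -> R[i]} := fun g => `[< exists u, represents u g >].

Lemma represents_linear a u v g h : represents u g -> represents v h ->
  represents (fun n => a *: u n + v n) (a *: g + h).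
Proof.
move=> [c ug] [d vh]; exists (rnorm a * c + d) => n y.
rewrite psd_linear !fctE opprD addrACA -mulrBr.
apply: le_trans (rnormvD _ _) _; rewrite rnormM !mulrDl -!mulrA.
by rewrite lerD// ?ler_wpM2l ?rnorm_ge0// mulrA.
Qed.

Lemma represents_cst x : represents (fun=> x) (B x).
Proof. by exists 0 => n y; rewrite subrr rnorm0 !mul0r. Qed.

Lemma hcompl_submod_closed : submod_closed hcompl_pred.
Proof.
split; first by apply/asboolP; exists (fun=> 0); exists 0 => n y;
  rewrite psd0l subrr rnorm0 !mul0r.
move=> a g h /asboolP[u ug] /asboolP[v vh]; apply/asboolP.
by exists (fun n => a *: u n + v n); exact: represents_linear.
Qed.

HB.instance Definition _ :=
  GRing.isSubmodClosed.Build R[i] (V -> R[i]) hcompl_pred hcompl_submod_closed.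

Record hcompl : Type := HCompl { hcompl_val :> V -> R[i] ; _ : hcompl_val \in hcompl_pred }.

HB.instance Definition _ := [isSub for hcompl_val].
HB.instance Definition _ := [Choice of hcompl by <:].
HB.instance Definition _ := [SubChoice_isSubLmodule of hcompl by <:].

Lemma hcomplP (g : hcompl) : exists u, represents u g.
Proof. by have := valP g; rewrite unfold_in => /asboolP. Qed.

Lemma hcompl_eq (g h : hcompl) : g =1 h -> g = h.
Proof. by move=> gh; apply/val_inj/funext. Qed.

Lemma represents_hcompl u g : represents u g -> g \in hcompl_pred.
Proof. by move=> ug; rewrite unfold_in; apply/asboolP; exists u. Qed.

Definition hembed x : hcompl := HCompl (represents_hcompl (represents_cst x)).

(** The uniform estimate is tested on [y = u n - v m] itself: it bounds [psdn B y ^+ 2] by a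
    multiple of [psdn B y], which cancels. *)
Lemma represents_close u v g : represents u g -> represents v g ->
  exists2 c : R, 0 <= c & forall n m, psdn B (u n - v m) <= c * rate R n + c * rate R m.
Proof.
move=> [c1 h1] [c2 h2]; exists (`|c1| + `|c2|); first by rewrite addr_ge0.
move=> n m; set y := u n - v m.
have [y0|y0] := eqVneq (psdn B y) 0.
  by rewrite y0 addr_ge0// mulr_ge0 ?addr_ge0// ltW// rate_gt0.
have y1 : 0 < psdn B y by rewrite lt_neqAle eq_sym y0 psdn_ge0.
have : psdn B y * psdn B y <= (c2 * rate R m + c1 * rate R n) * psdn B y.
  have -> : psdn B y * psdn B y = rnorm (B y y).
    by rewrite psdE rnorm_real ger0_norm ?sqr_ge0// expr2.
  have -> : B y y = (g y - B (v m) y) - (g y - B (u n) y).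
    by rewrite opprB [RHS]addrC addrA subrK -psdBl.
  by apply: le_trans (rnormvB _ _) _; rewrite mulrDl lerD.
rewrite ler_pM2r// => /le_trans; apply.
rewrite addrC; apply: lerD; rewrite ler_wpM2r ?(ltW (rate_gt0 _ _))//.
  by apply: le_trans (ler_norm c1) _; rewrite lerDl.
by apply: le_trans (ler_norm c2) _; rewrite lerDr.
Qed.

(** Two pairs of sequences are compared at once: equal pairs give convergence of the inner products,
    distinct pairs show that the limit does not depend on the representatives. *)
Lemma represents_cauchy u u' v v' g h :
  represents u g -> represents u' g -> represents v h -> represents v' h ->
  exists c : R, forall n m,
    rnorm (B (u n) (v n) - B (u' m) (v' m)) <= c * rate R n + c * rate R m.
Proof.
have bound u1 (f : V -> R[i]) : represents u1 f ->
    exists2 k : R, 0 <= k & forall n, psdn B (u1 n) <= k.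
  move=> uf; have [c c0 hc] := represents_close uf uf.
  exists (c + c + psdn B (u1 0%N)); first by rewrite !addr_ge0// psdn_ge0.
  move=> n; rewrite -{1}(subrK (u1 0%N) (u1 n)).
  apply: le_trans (psdnD _ _ _) _; rewrite lerD2r; apply: le_trans (hc _ _) _.
  by rewrite lerD// rate_le.
move=> ug u'g vh v'h.
have [c c0 hc] := represents_close ug u'g; have [d d0 hd] := represents_close vh v'h.
have [k k0 hk] := bound _ _ vh; have [l l0 hl] := bound _ _ u'g.
exists (c * k + l * d) => n m.
have -> : B (u n) (v n) - B (u' m) (v' m) =
    B (u n - u' m) (v n) + B (u' m) (v n - v' m).
  by rewrite psdBl psdBr addrA subrK.
apply: le_trans (rnormD _ _) _.
apply: (@le_trans _ _ ((c * rate R n + c * rate R m) * k + l * (d * rate R n + d * rate R m))).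
  apply: lerD; apply: le_trans (psd_CauchySchwarz _ _ _) _.
    by rewrite ler_pM ?psdn_ge0.
  by rewrite ler_pM ?psdn_ge0.
by rewrite le_eqVlt; apply/orP; left; apply/eqP; ring.
Qed.

Definition hrepr (g : hcompl) : nat -> V := projT1 (cid (hcomplP g)).

Lemma hreprP g : represents (hrepr g) g.
Proof. exact: projT2 (cid (hcomplP g)). Qed.

Lemma hinner_subproof g h :
  exists l, rate_cvg (fun n => B (hrepr g n) (hrepr h n)) l.
Proof.
apply: complex_rate_complete.
exact: (represents_cauchy (hreprP g) (hreprP g) (hreprP h) (hreprP h)).
Qed.

Definition hinner g h : R[i] := projT1 (cid (hinner_subproof g h)).

Lemma hinner_cvg (g h : hcompl) u v : represents u g -> represents v h ->
  rate_cvg (fun n => B (u n) (v n)) (hinner g h).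
Proof.
move=> ug vh; have [c hc] := projT2 (cid (hinner_subproof g h)).
have [d hd] := represents_cauchy (hreprP g) ug (hreprP h) vh.
exists (c + (d + d)) => n; rewrite -/(hinner g h) in hc.
apply: le_trans (rnormv_dist (B (hrepr g n) (hrepr h n)) _ _) _.
by rewrite mulrDl lerD// mulrDl.
Qed.

Lemma hinner_linear a (g h k : hcompl) :
  hinner (a *: g + h) k = a * hinner g k + hinner h k.
Proof.
have gk := hinner_cvg (hreprP g) (hreprP k).
have hk := hinner_cvg (hreprP h) (hreprP k).
have := rate_cvgD (rate_cvgM a gk) hk; apply: rate_cvg_unique.
under eq_fun do rewrite -psd_linear.
exact: (@hinner_cvg (a *: g + h) k _ _ (represents_linear a (hreprP g) (hreprP h)) (hreprP k)).
Qed.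

Lemma hinner_herm (g h : hcompl) : hinner h g = (hinner g h)^*.
Proof.
have := rate_cvg_conj (hinner_cvg (hreprP g) (hreprP h)); apply: rate_cvg_unique.
under eq_fun do rewrite -psd_herm.
exact: (hinner_cvg (hreprP h) (hreprP g)).
Qed.

Lemma hinner_ge0 (g : hcompl) : 0 <= complex.Re (hinner g g).
Proof.
apply: rate_cvg_Re_ge (hinner_cvg (hreprP g) (hreprP g)) _ => n.
exact: psd_ge0.
Qed.

Definition hform : psdForm hcompl := PsdForm hinner_linear hinner_herm hinner_ge0.

(** The reproducing property: evaluation at [y] is the inner product with [hembed y]. Hence a vector
    of norm zero vanishes pointwise. *)
Lemma hinner_embed (g : hcompl) y : hinner g (hembed y) = g y.
Proof.
apply: (rate_cvg_unique (@hinner_cvg g (hembed y) _ _ (hreprP g) (represents_cst y))).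
have [c hc] := hreprP g; exists (c * psdn B y) => n.
by rewrite mulrAC; exact: hc.
Qed.

Lemma hembed_linear a x y : hembed (a *: x + y) = a *: hembed x + hembed y.
Proof. by apply: hcompl_eq => z; rewrite /= psd_linear. Qed.

Lemma hembedB x y : hembed (x - y) = hembed x - hembed y.
Proof. by apply: hcompl_eq => z; rewrite /= psdBl. Qed.

Lemma hcompl_semilinear (g : hcompl) a x y : g (a *: x + y) = a^* * g x + g y.
Proof.
rewrite -!hinner_embed hembed_linear.
by have := psdDr hform g (a *: hembed x) (hembed y); rewrite psdZr.
Qed.

Lemma psdn_hembed x : psdn hform (hembed x) = psdn B x.
Proof. by rewrite /psdn /= hinner_embed. Qed.

Lemma hnorm_eq0 (g : hcompl) : psdn hform g = 0 -> g = 0.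
Proof.
move=> g0; apply: hcompl_eq => y; rewrite -hinner_embed.
apply: rnormv_eq0; apply/eqP; rewrite eq_le rnorm_ge0 andbT.
by have := psd_CauchySchwarz hform g (hembed y); rewrite g0 mul0r.
Qed.

Definition hnorm (g : hcompl) : R[i] := (psdn hform g)%:C.

Lemma hnormD g h : hnorm (g + h) <= hnorm g + hnorm h.
Proof. by rewrite -rmorphD lecR psdnD. Qed.

Lemma hnormZ a g : hnorm (a *: g) = `|a| * hnorm g.
Proof. by rewrite /hnorm psdnZ rmorphM normr_rnorm. Qed.

Lemma hnorm_eq0C g : hnorm g = 0 -> g = 0.
Proof. by move=> /(congr1 (@complex.Re R)) /=; exact: hnorm_eq0. Qed.

HB.instance Definition _ :=
  Lmodule_isNormed.Build R[i] hcompl hnormD hnormZ hnorm_eq0C.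

Lemma rnorm_hcompl (g : hcompl) : rnorm g = psdn hform g.
Proof. by []. Qed.

Lemma represents_cvg u (g : hcompl) : represents u g ->
  rate_cvg (fun n => hembed (u n)) g.
Proof.
move=> ug; have [c c0 hc] := represents_close ug ug; exists c => n.
rewrite rnorm_hcompl -ler_sqr ?nnegrE ?psdn_ge0 ?mulr_ge0 ?(ltW (rate_gt0 _ _))//.
have gu : represents (fun m => (-1) *: u n + u m) (g - hembed (u n)).
  have -> : g - hembed (u n) = -1 *: (hembed (u n)) + g.
    by rewrite scaleN1r addrC.
  exact: represents_linear (represents_cst _) ug.
(* With [r], [t] the rates at [n], [m], both at most 1, the square of [c * r + c * t] exceeds that
   of [c * r] by [c ^+ 2 * (2 * r + t) * t], hence by at most [3 * c ^+ 2 * t]. *)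
rewrite psdn_sqr; apply: (rate_cvg_Re_le (b := 3 * c ^+ 2) (hinner_cvg gu gu)) => m.
rewrite -psdn_sqr scaleN1r addrC.
apply: (@le_trans _ _ ((c * rate R n + c * rate R m) ^+ 2)).
  by rewrite ler_sqr ?nnegrE ?psdn_ge0 ?addr_ge0 ?mulr_ge0 ?(ltW (rate_gt0 _ _))//
    psdnC.
have := rate_gt0 R n; have := rate_gt0 R m.
have := rate_le1 R n; have := rate_le1 R m.
move: (rate R n) (rate R m) => r t t1 r1 t0 r0.
have -> : (c * r + c * t) ^+ 2 = (c * r) ^+ 2 + c ^+ 2 * ((2 * r + t) * t) by ring.
have h : (2 * r + t) * t <= 3 * t by rewrite ler_wpM2r ?(ltW t0)//; lra.
by have := ler_wpM2l (sqr_ge0 c) h; lra.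
Qed.

Lemma represents_limit u c :
  (forall n m, psdn B (u n - u m) <= c * rate R n + c * rate R m) ->
  exists g : hcompl, represents u g.
Proof.
move=> hc.
have cv y : exists l, forall n, rnorm (l - B (u n) y) <= c * rate R n * psdn B y.
  have hB n m : rnorm (B (u n) y - B (u m) y) <=
      c * psdn B y * rate R n + c * psdn B y * rate R m.
    rewrite -psdBl; apply: le_trans (psd_CauchySchwarz _ _ _) _.
    have -> : c * psdn B y * rate R n + c * psdn B y * rate R m =
      (c * rate R n + c * rate R m) * psdn B y by ring.
    by rewrite ler_wpM2r ?psdn_ge0.
  have [|l [d hl]] := @complex_rate_complete _ (fun n => B (u n) y).
    by exists (c * psdn B y).
  (* The constant [d] depends on [y] in an uncontrolled way; letting [m] grow removes it and leaves
     a bound uniform in [y]. *)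
  exists l => n; apply: (@ler_rate _ _ _ (d + c * psdn B y)) => m.
  apply: le_trans (rnormv_dist (B (u m) y) _ _) _.
  have := hB m n; have := hl m; rewrite [c * _ * psdn B y]mulrAC; lra.
have [g gP] := choice cv.
have ug : represents u g by exists c => n y.
by exists (HCompl (represents_hcompl ug)).
Qed.

Lemma hcompl_complete (F : set_system hcompl) : ProperFilter F -> cauchy F -> cvg F.
Proof.
apply: rate_complete => g [c hc].
have approx n : exists x, rnorm (g n - hembed x) <= rate R n.
  have [d hd] := represents_cvg (hreprP (g n)).
  have [N /(_ N (leqnn N)) hN] := rate_lt d (rate_gt0 R n).
  by exists (hrepr (g n) N); apply: le_trans (hd N) (ltW hN).
have [w hw] := choice approx.
have [|h wh] := @represents_limit w (1 + c).
  move=> n m; rewrite -psdn_hembed hembedB -rnorm_hcompl.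
  apply: le_trans (rnormv_dist (g n) _ _) _.
  apply: le_trans (lerD (lexx _) (rnormv_dist (g m) _ _)) _.
  have := hw n; have := hw m; have := hc n m; rewrite (rnormvC (hembed _)); lra.
have [d hd] := represents_cvg wh; exists h, (d + 1) => n.
apply: le_trans (rnormv_dist (hembed (w n)) _ _) _.
by rewrite mulrDl mul1r lerD// rnormvC.
Qed.

HB.instance Definition _ := Uniform_isComplete.Build hcompl hcompl_complete.

Lemma hinner_gt0 (g : hcompl) : g != 0 -> 0 < hinner g g.
Proof.
move=> g0; have := psdE hform g; rewrite /= => ->.
rewrite -[0]/(0%:C) ltcR exprn_gt0// lt_neqAle psdn_ge0 andbT eq_sym.
by apply: contra g0 => /eqP /hnorm_eq0 ->.
Qed.

Lemma hinner_bilinear : @bilinear_for R[i] hcompl hcompl R[i] *%R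
  (Num.conj \; *%R : GRing.Scale.law R[i] R[i]) hinner.
Proof.
split=> h a x y; first exact: hinner_linear.
by have := psdDr hform h (a *: x) y; rewrite psdZr.
Qed.

HB.instance Definition _ := bilinear_isBilinear.Build R[i] hcompl hcompl R[i]
  *%R (Num.conj \; *%R) hinner hinner_bilinear.

Lemma hinner_hermitian g h : hinner g h = (-1) ^+ false * (hinner h g)^*.
Proof. by rewrite expr0 mul1r -hinner_herm. Qed.

HB.instance Definition _ := isHermitianSesquilinear.Build R[i] hcompl false
  Num.conj hinner hinner_hermitian.

HB.instance Definition _ := isDotProduct.Build R[i] hcompl hinner hinner_gt0.

Lemma hcompl_normE (g : hcompl) : `|g| ^+ 2 = hinner g g.
Proof. by rewrite normr_rnorm rnorm_hcompl -rmorphXn /= -(psdE hform). Qed.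

Definition hcompl_hilbert : hilbertSpace R :=
  @HilbertSpace R hcompl (hinner : {dot hcompl for (@Num.conj R[i])}) hcompl_normE.
End Completion.

(** * C*-algebras and their states *)

Section HilbertForm.
Variables (R : realType) (H : hilbertSpace R).
Implicit Types u v w : H.

Lemma inner_linear (a : R[i]) u v w :
  inner H (a *: u + v) w = a * inner H u w + inner H v w.
Proof. by rewrite linearDl linearZl_LR. Qed.

Lemma inner_herm u v : inner H v u = (inner H u v)^*.
Proof. by rewrite (hermC (inner H) v u) /= expr0 mul1r. Qed.

Lemma inner_ge0 u : 0 <= complex.Re (inner H u u).
Proof. by rewrite -hilbert_normE normr_rnorm -rmorphXn /= sqr_ge0. Qed.

Definition inner_form : psdForm H := PsdForm inner_linear inner_herm inner_ge0.

Lemma psdn_inner u : psdn inner_form u = rnorm u.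
Proof.
apply: psdnE; first exact: rnormv_ge0.
by rewrite /= -hilbert_normE normr_rnorm -rmorphXn.
Qed.

Lemma inner_rnorm u : inner H u u = (rnorm u ^+ 2)%:C.
Proof. by rewrite -psdn_inner -psdE. Qed.

End HilbertForm.

Section OperatorNorm.
Variables (R : realType) (H : hilbertSpace R).

Lemma opnorm_le (T : H -> H) (c : R) : 0 <= c ->
  (forall u, rnorm (T u) <= c * rnorm u) -> (opnorm T <= c%:E)%E.
Proof.
move=> c0 h; apply: ge_ereal_sup => _ [u u1 <-]; rewrite lee_fin.
apply: le_trans (h u) _; rewrite ler_piMr//.
by rewrite rnorm_le_normr.
Qed.

Lemma le_opnorm (T : H -> H) (c : R) : linear T -> (opnorm T <= c%:E)%E ->
  forall u, rnorm (T u) <= c * rnorm u.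
Proof.
move=> lT h u.
have TZ a v : T (a *: v) = a *: T v.
  have T0 : T 0 = 0.
    by have := lT 1 0 0; rewrite !scale1r addr0 => /(congr1 (+%R^~ (- T 0))); rewrite addrK subrr.
  by have := lT a v 0; rewrite T0 !addr0.
have [u0|u0] := eqVneq (rnorm u) 0.
  have -> : u = 0 *: 0 by rewrite scaler0; exact: rnormv_eq0.
  by rewrite TZ scale0r scaler0 rnormv0 mulr0.
have up : 0 < rnorm u by rewrite lt_neqAle eq_sym u0 rnormv_ge0.
have : ((rnorm (T ((rnorm u)^-1%:C *: u)))%:E <= c%:E)%E.
  apply: le_trans h; apply: ereal_sup_ubound; exists ((rnorm u)^-1%:C *: u) => //=.
  rewrite -[1]/(1%:C) -rnorm_le_normr rnormZ rnorm_real gtr0_norm ?invr_gt0//.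
  by rewrite mulVf.
by rewrite lee_fin TZ rnormZ rnorm_real gtr0_norm ?invr_gt0// ler_pdivrMl// mulrC.
Qed.

End OperatorNorm.

Section UniversalPositivity.
Variables (R : realType) (B : starAlgType R) (H : hilbertSpace R) (pi : starRep B H).

(* [pi 1] is only a projection, which is why [1] is not replaced by the identity. *)
Lemma rep_sqr_sub_le (b : B) (c : R) : 0 <= c ->
  (forall u, rnorm (pi b u) <= c * rnorm u) ->
  (forall u, rnorm (pi (star b) u) <= c * rnorm u) ->
  forall u, rnorm (pi ((c ^+ 2)%:C *: 1 - star b * b) u) <= c ^+ 2 * rnorm u.
Proof.
move=> c0 bc bsc u.
pose P := pi 1 u; pose T := pi b u; pose S := pi (star b) T.
have star1 : star (1 : B) = 1 by rewrite -[LHS]mulr1 -{2}(starK 1) -starM mulr1 starK.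
have piB : pi ((c ^+ 2)%:C *: 1 - star b * b) u = (c ^+ 2)%:C *: P - S.
  by rewrite -scaleN1r repD !repZ repM scaleN1r.
have SP : inner H S P = (rnorm T ^+ 2)%:C.
  rewrite /S rep_star starK -inner_rnorm /P -repM mulr1//.
have P1 : rnorm P <= rnorm u.
  have := psd_CauchySchwarz (inner_form H) P u; rewrite !psdn_inner /=.
  have -> : inner H P u = inner H P P by rewrite /P rep_star star1 [RHS]rep_star star1 -repM mulr1.
  rewrite inner_rnorm rnorm_real ger0_norm ?sqr_ge0// expr2.
  have [->|P0] := eqVneq (rnorm P) 0; first by rewrite rnormv_ge0.
  by rewrite ler_pM2l// lt_neqAle eq_sym P0 rnormv_ge0.
(* The square of the left side is [c ^+ 4 * rnorm P ^+ 2 - 2 * c ^+ 2 * rnorm T ^+ 2 + rnorm S ^+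
   2], and [rnorm S <= c * rnorm T] makes the last two terms together nonpositive. *)
rewrite piB -ler_sqr ?nnegrE ?mulr_ge0 ?rnormv_ge0 ?sqr_ge0//.
rewrite -!psdn_inner psdn_sqrD psdnN psdnZ psdNr psdZl /= rnorm_real.
have -> : inner H P S = (rnorm T ^+ 2)%:C by rewrite inner_herm SP [LHS]conjc_real.
rewrite -rmorphM -rmorphN /= !psdn_inner.
rewrite ger0_norm ?sqr_ge0//.
have S2 : rnorm S ^+ 2 <= c ^+ 2 * rnorm T ^+ 2.
  by rewrite -exprMn ler_sqr ?nnegrE ?mulr_ge0 ?rnormv_ge0// bsc.
have P2 : (c ^+ 2 * rnorm P) ^+ 2 <= (c ^+ 2 * rnorm u) ^+ 2.
  by rewrite ler_sqr ?nnegrE ?mulr_ge0 ?rnormv_ge0 ?sqr_ge0// ler_wpM2l ?sqr_ge0.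
have := mulr_ge0 (sqr_ge0 c) (sqr_ge0 (rnorm T)).
lra.
Qed.

End UniversalPositivity.

(** * Norm of the adjoint and the Neumann series *)

Section CstarBasics.
Variables (R : realType) (A : cstarAlgebra R).
Implicit Types x y : A.

Lemma cstar_rnormM x y : rnorm (x * y) <= rnorm x * rnorm y.
Proof.
by rewrite rnorm_le_normr rmorphM /= -!normr_rnorm; exact: cstar_normM.
Qed.

Lemma cstar_rnormE x : rnorm (star x * x) = rnorm x ^+ 2.
Proof.
rewrite {1}/rnorm; have -> : `|star x * x| = `|x| ^+ 2 by exact: cstar_normE.
by rewrite normr_rnorm -rmorphXn.
Qed.

Lemma cstar_rnorm_star x : rnorm (star x) = rnorm x.
Proof.
have le y : rnorm y <= rnorm (star y).
  have [y0|y0] := eqVneq (rnorm y) 0; first by rewrite y0 rnormv_ge0.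
  have yp : 0 < rnorm y by rewrite lt_neqAle eq_sym y0 rnormv_ge0.
  by have := cstar_rnormM (star y) y; rewrite cstar_rnormE expr2 ler_pM2r.
by apply/eqP; rewrite eq_le le andbT; have := le (star x); rewrite starK.
Qed.

Lemma star1 : star (1 : A) = 1.
Proof. by rewrite -[LHS]mulr1 -{2}(starK 1) -starM mulr1 starK. Qed.

Lemma starN x : star (- x) = - star x.
Proof. by rewrite -scaleN1r starZ rmorphN1 scaleN1r. Qed.

Lemma starB x y : star (x - y) = star x - star y.
Proof. by rewrite starD starN. Qed.

Lemma cstar_rnorm1 : rnorm (1 : A) = 1.
Proof.
have := cstar_rnormE 1; rewrite star1 mulr1 expr2 => /esym.
have n0 : rnorm (1 : A) != 0 by apply/eqP => /rnormv_eq0/eqP; rewrite oner_eq0.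
by move=> h; apply: (mulfI n0); rewrite mulr1.
Qed.

(** Since [q * (2 - q) <= 1], it suffices to bound the powers of [2 - q = 1 + (1 - q)] from below,
    which is Bernoulli's inequality. *)
Lemma pow_le_rate (q : R) : 0 <= q < 1 -> forall n, q ^+ n <= (1 - q)^-1 * rate R n.
Proof.
move=> /andP[q0 q1] n; have d0 : 0 < 1 - q by rewrite subr_gt0.
rewrite /rate -invfM -[leRHS]mul1r ler_pdivlMr ?mulr_gt0//.
have bern : 1 + n%:R * (1 - q) <= (2 - q) ^+ n.
  elim: n => [|n IH]; first by rewrite mul0r addr0.
  rewrite exprS; apply: (@le_trans _ _ ((2 - q) * (1 + n%:R * (1 - q)))).
    rewrite -natr1; have : 0 <= n%:R * (1 - q) by rewrite mulr_ge0// ltW.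
    nra.
  by rewrite ler_wpM2l//; lra.
have : q ^+ n * (2 - q) ^+ n <= 1.
  rewrite -exprMn exprn_ile1//; first by apply: mulr_ge0 => //; lra.
  nra.
apply: le_trans; apply: ler_wpM2l; first exact: exprn_ge0.
by apply: le_trans bern; rewrite -natr1; lra.
Qed.

(** Partial sums of the geometric series in Horner form, with [n] terms. *)
Fixpoint neumann x n : A := if n is m.+1 then 1 + x * neumann x m else 0.

Lemma neumann_comm x n : x * neumann x n = neumann x n * x.
Proof.
elim: n => [|n IH] /=; first by rewrite mulr0 mul0r.
by rewrite mulrDr mulrDl mulr1 mul1r -mulrA -IH.
Qed.

Lemma invertible_near1 x : rnorm x < 1 -> invertible (1 - x).
Proof.
move=> x1; set q := rnorm x in x1; have q0 : 0 <= q by exact: rnormv_ge0.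
have d0 : 0 < 1 - q by rewrite subr_gt0.
have bd n : rnorm (neumann x n) <= (1 - q)^-1.
  elim: n => [|n IH] /=; first by rewrite rnormv0 invr_ge0 ltW.
  apply: le_trans (rnormvD _ _) _; rewrite cstar_rnorm1.
  apply: le_trans (lerD (lexx _) (cstar_rnormM _ _)) _.
  apply: le_trans (lerD (lexx _) (ler_wpM2l q0 IH)) _.
  by rewrite le_eqVlt; apply/orP; left; apply/eqP; field; rewrite lt0r_neq0.
have dist n k : rnorm (neumann x (n + k) - neumann x n) <= q ^+ n * (1 - q)^-1.
  elim: n => [|n IH]; first by rewrite add0n subr0 mul1r.
  rewrite addSn /= opprD addrACA subrr add0r -mulrBr exprS -mulrA.
  by apply: le_trans (cstar_rnormM _ _) (ler_wpM2l q0 IH).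
have C0 : 0 <= (1 - q)^-1 ^+ 2 by exact: sqr_ge0.
have rcau : rate_cauchy (neumann x).
  exists ((1 - q)^-1 ^+ 2) => n m.
  wlog nm : n m / (n <= m)%N => [hw|].
    have [/hw//|/ltnW mn] := leqP n m.
    by rewrite rnormvC [leRHS]addrC; exact: hw.
  rewrite rnormvC -(subnKC nm); apply: le_trans (dist _ _) _.
  rewrite mulrC; apply: (@le_trans _ _ ((1 - q)^-1 ^+ 2 * rate R n)).
    by rewrite expr2 -mulrA ler_wpM2l ?invr_ge0 ?(ltW d0)// pow_le_rate// q0.
  by rewrite lerDl mulr_ge0// ltW// rate_gt0.
have [l [c hc]] := rate_cauchy_cvg rcau.
(* The limit inherits the recursion. Taking for [F] the left, then the right multiplication by [x]
   makes [l] an inverse of [1 - x] on both sides. *)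
have fixpoint (F : A -> A) : (forall y z, rnorm (F y - F z) <= q * rnorm (y - z)) ->
    (forall n, neumann x n.+1 = 1 + F (neumann x n)) -> l = 1 + F l.
  move=> Fq Fn; apply/eqP; rewrite -subr_eq0; apply/eqP/rnormv_eq0/eqP.
  rewrite eq_le rnormv_ge0 andbT; apply: (@ler_rate _ _ _ (c + q * c)) => n.
  have c0 : 0 <= c.
    by have := le_trans (rnormv_ge0 _) (hc 0%N); rewrite /rate invr1 mulr1.
  rewrite add0r mulrDl; apply: le_trans (rnormv_dist (neumann x n.+1) _ _) _.
  apply: lerD.
    apply: le_trans (hc n.+1) _; rewrite ler_wpM2l// /rate lef_pV2 ?posrE//.
    by rewrite ler_nat.
  rewrite Fn opprD addrACA subrr add0r; apply: le_trans (Fq _ _) _.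
  by rewrite -mulrA ler_wpM2l// rnormvC.
exists l; split; rewrite ?mulrBl ?mulrBr ?mul1r ?mulr1.
  rewrite {1}(@fixpoint (fun y => x * y)) ?addrK// => [y z].
  by rewrite -mulrBr cstar_rnormM.
rewrite {1}(@fixpoint (fun y => y * x)) ?addrK// => [y z|n].
  by rewrite -mulrBl [leRHS]mulrC cstar_rnormM.
by rewrite /= neumann_comm.
Qed.

End CstarBasics.

Section Realified.
Variables (R : realType) (V : lmodType R[i]).

(** A separate name for [V], so that restricting the scalars to the reals does not compete with the
    complex structure. *)
Definition realified : Type := V.

HB.instance Definition _ := GRing.Zmodule.on realified.

Lemma real_scalerA (r s : R) (x : realified) :
  r%:C *: ((s%:C *: (x : V)) : V) = (r * s)%:C *: (x : V).
Proof. by rewrite scalerA rmorphM. Qed.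

Lemma real_scale1r (x : realified) : (1 : R)%:C *: (x : V) = x.
Proof. exact: scale1r. Qed.

Lemma real_scalerDr :
  right_distributive (fun (r : R) (x : realified) => r%:C *: (x : V) : realified) +%R.
Proof. by move=> r x y; exact: scalerDr. Qed.

Lemma real_scalerDl (x : realified) :
  {morph (fun r : R => r%:C *: (x : V) : realified) : r s / r + s}.
Proof. by move=> r s; rewrite rmorphD; exact: scalerDl. Qed.

HB.instance Definition _ := GRing.Zmodule_isLmodule.Build R realified
  real_scalerA real_scale1r real_scalerDr real_scalerDl.

End Realified.

(** * States and the existence of pure states *)

Section States.
Variables (R : realType) (A : cstarAlgebra R).
Implicit Types (x y z : A) (f : A -> R).

Definition sa_norm x : R := rnorm (x + star x) / 2.

(* Real parts of states: being below [sa_norm] makes [f] vanish on the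
   antihermitian elements and bounded by the norm on the hermitian ones. *)
Definition state f :=
  [/\ scalar (f : realified A -> R), forall x, f x <= sa_norm x & f 1 = 1].

Definition pure_state f := state f /\ forall t f1 f2, 0 < t < 1 ->
  state f1 -> state f2 -> (forall x, f x = t * f1 x + (1 - t) * f2 x) -> f1 = f.

Lemma sublinear_sa_norm : sublinear (sa_norm : realified A -> R).
Proof.
split=> [x y|r x r0]; rewrite /sa_norm.
  by rewrite -mulrDl ler_wpM2r ?invr_ge0// starD addrACA rnormvD.
rewrite mulrA ler_wpM2r ?invr_ge0//.
have -> : ((r *: x : realified A) : A) = r%:C *: (x : A) by [].
rewrite starZ [_^*]conjc_real -scalerDr rnormZ rnorm_real gtr0_norm//.
Qed.

Lemma sa_norm_sa x : star x = x -> sa_norm x = rnorm x.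
Proof.
move=> sx; rewrite /sa_norm sx -mulr2n -scaler_nat rnormZ.
have -> : rnorm (2%:R : R[i]) = 2.
  by rewrite -(rmorph_nat (real_complex R)) rnorm_real ger0_norm.
by rewrite mulrC mulKf.
Qed.

Lemma sa_norm_le x : sa_norm x <= rnorm x.
Proof.
rewrite /sa_norm ler_pdivrMr// mulr_natr mulr2n.
by apply: le_trans (rnormvD _ _) _; rewrite cstar_rnorm_star.
Qed.

Section StateFacts.
Variable f : A -> R.
Hypothesis sf : state f.

Lemma state_linear (r : R) x y : f (r%:C *: x + y) = r * f x + f y.
Proof. by have [lf _ _] := sf; exact: lf. Qed.

Lemma stateD x y : f (x + y) = f x + f y.
Proof. by have := state_linear 1 x y; rewrite scale1r mul1r. Qed.

Lemma stateN x : f (- x) = - f x.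
Proof. by have [lf _ _] := sf; exact: (@scalar_opp R (realified A) f x lf). Qed.

Lemma state0 : f 0 = 0.
Proof. by have := stateD 0 0; rewrite addr0; lra. Qed.

Lemma stateZ (r : R) x : f (r%:C *: x) = r * f x.
Proof. by have := state_linear r x 0; rewrite addr0 state0 addr0. Qed.

(** [sa_norm] vanishes on [x - star x] and on its opposite, so [f] is nonpositive on both. *)
Lemma state_star x : f (star x) = f x.
Proof.
have [_ fp _] := sf.
have sa0 y : star y = - y -> f y <= 0.
  by move=> yN; apply: le_trans (fp y) _; rewrite /sa_norm yN subrr rnormv0 mul0r.
have := sa0 (x - star x); have := sa0 (star x - x).
rewrite !starB !starK !opprB !stateD !stateN => /(_ erefl) h1 /(_ erefl) h2; lra.
Qed.

Lemma state_norm_le x : `|f x| <= rnorm x.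
Proof.
have [_ fp _] := sf; rewrite ler_norml lerNl -stateN -{1}rnormvN.
by rewrite !(le_trans (fp _) (sa_norm_le _)).
Qed.

(** The complex-linear functional with real part [f]. *)
Definition cstate x : R[i] := f x +i* - f ((0 +i* 1) *: x).

Lemma cstate_linear (a : R[i]) x y : cstate (a *: x + y) = a * cstate x + cstate y.
Proof.
have fZ (r s : R) z : f ((r +i* s) *: z) = r * f z + s * f ((0 +i* 1) *: z).
  have -> : r +i* s = r%:C + s%:C * (0 +i* 1).
    by apply: complexP => /=; ring.
  by rewrite scalerDl -scalerA stateD !stateZ.
case: a => r s; apply: complexP; rewrite /= ?scalerDr !stateD ?scalerA fZ.
  by ring.
by ring.
Qed.

Lemma cstate_star x : cstate (star x) = (cstate x)^*.
Proof.
rewrite /cstate state_star; apply: complexP => //=.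
rewrite -{1}(state_star (_ *: star x)) starZ starK.
have -> : (0 +i* 1)^* = - (0 +i* 1) :> R[i] by apply: complexP => /=; ring.
by rewrite scaleNr stateN.
Qed.

End StateFacts.

Lemma support_face_one_le f : (forall x, f x <= sa_norm x) ->
  scalar (f : realified A -> R) ->
  (forall x, f x <= support_face (sa_norm : realified A -> R) 1 x) -> f 1 = 1.
Proof.
move=> fp lf h; have sp := sublinear_sa_norm.
have p1 : sa_norm 1 = 1 by rewrite sa_norm_sa ?star1// cstar_rnorm1.
have := le_trans (h (- 1)) (support_faceN _ sp).
by rewrite (scalar_opp _ lf) p1; have := fp 1; rewrite p1; lra.
Qed.

(** Otherwise [t^-1%:C *: h] is at distance less than 1 from [1], and the Neumann series inverts
    it. *)
Lemma rnorm_sub_noninvertible (h : A) (t : R) : 0 <= t -> ~ invertible h ->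
  t <= rnorm (- h + t%:C *: 1).
Proof.
rewrite le_eqVlt => /predU1P[<-|t0] hN; first by rewrite rnormv_ge0.
rewrite leNgt; apply/negP => ht; apply: hN.
have tC : t%:C != 0 :> R[i] by rewrite -[0]/(0%:C) (inj_eq (@complexI _)) lt0r_neq0.
have [|y [xy yx]] := @invertible_near1 R A (1 - t^-1%:C *: h).
  have -> : 1 - t^-1%:C *: h = t^-1%:C *: (- h + t%:C *: 1).
    by rewrite scalerDr scalerA -rmorphM mulVf ?lt0r_neq0// scale1r scalerN addrC.
  by rewrite rnormZ rnorm_real gtr0_norm ?invr_gt0// mulrC ltr_pdivrMr// mul1r.
move: xy yx; rewrite subKr -scalerAl -scalerAr => xy yx.
by exists (t^-1%:C *: y); rewrite -scalerAr -scalerAl.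
Qed.

Lemma ex_pure_state (h : A) : star h = h -> ~ invertible h ->
  exists f, pure_state f /\ f h <= 0.
Proof.
move=> sh hN; pose p : realified A -> R := sa_norm.
have sp : sublinear p by exact: sublinear_sa_norm.
have p1 : p 1 = 1 by rewrite /p sa_norm_sa ?star1// cstar_rnorm1.
(* The linear functionals below [q1] are the states, those below [q0] the states with the least
   value at [h]. *)
pose q1 := support_face p (1 : A); pose q0 := support_face q1 (- h : A).
have sq1 : sublinear q1 by exact: sublinear_support_face.
have sq0 : sublinear q0 by exact: sublinear_support_face.
have q1p x : q1 x <= p x by exact: support_face_self.
have q01 x : q0 x <= q1 x by exact: support_face_self.
have q0p x : q0 x <= p x by exact: le_trans (q01 x) (q1p x).
have fp : face p p by move=> t f1 f2.
have fq1 : face p q1 by apply: face_support_face.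
have fq0 : face p q0 by apply: face_support_face.
have [f [lf fq ext]] := extreme_scalar_below sp sq0 q0p fq0.
exists f; split; last first.
  (* [q1 (- h)] is the infimum over [0 <= t] of [rnorm (- h + t%:C *: 1) - t], and each of these
     terms is nonnegative. *)
  have q1h : 0 <= q1 (- h : A).
    apply: le_support_face => t t0; rewrite p1 mulr1 subr_ge0.
    rewrite /p sa_norm_sa; first exact: rnorm_sub_noninvertible.
    by rewrite starD starN sh; congr (_ + _); rewrite starZ star1 [_^*]conjc_real.
  have hh : q0 (- (- h : A)) <= - q1 (- h : A) by exact: support_faceN.
  by rewrite opprK in hh; have := fq h; lra.
have fle x : f x <= p x by exact: le_trans (fq x) (q0p x).
split; first split=> //.
  by apply: support_face_one_le => // x; exact: le_trans (fq x) (q01 x).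
move=> t f1 f2 t01 [l1 f1p _] [l2 f2p _] fE; exact: (ext t f1 f2).
Qed.

End States.

Section Positivity.
Variables (R : realType) (B : starAlgType R) (A : cstarAlgebra R).
Variables (iota : {lrmorphism B -> A}) (AE : enveloping_cstar iota).

Lemma enveloping_sqr_sub_le b :
  rnorm ((rnorm (iota b) ^+ 2)%:C *: 1 - star (iota b) * iota b) <= rnorm (iota b) ^+ 2.
Proof.
have [iS iN _] := AE.
have -> : (rnorm (iota b) ^+ 2)%:C *: 1 - star (iota b) * iota b =
    iota ((rnorm (iota b) ^+ 2)%:C *: 1 - star b * b).
  have iM : iota (star b * b) = star (iota b) * iota b by rewrite -iS -rmorphM.
  by rewrite linearB linearZ rmorph1; congr (_ - _); exact: esym iM.
rewrite -lee_fin iN; apply: ge_ereal_sup => _ [H [pi ->]].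
apply: opnorm_le; first exact: sqr_ge0.
have bd c u : rnorm (pi c u) <= rnorm (iota c) * rnorm u.
  apply: le_opnorm; first exact: rep_linear.
  by rewrite iN; apply: ereal_sup_ubound; exists H, pi.
apply: rep_sqr_sub_le; first exact: rnormv_ge0.
  exact: bd.
by move=> u; have := bd (star b) u; rewrite iS cstar_rnorm_star.
Qed.

(** For [y] in the range of [iota] and [c = rnorm y], applying [f] to [c ^+ 2 - star y * y] gives
    [c ^+ 2 - f (star y * y) <= c ^+ 2]. Density and norm continuity of [f] do the rest. *)
Lemma state_ge0 (f : A -> R) x : state f -> 0 <= f (star x * x).
Proof.
move=> sf; have [_ fp f1] := sf; have [_ _ dA] := AE.
have pos b : 0 <= f (star (iota b) * iota b).
  have := le_trans (le_trans (fp _) (sa_norm_le _)) (enveloping_sqr_sub_le b).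
  by rewrite (stateD sf) (stateN sf) (stateZ sf) f1; lra.
rewrite leNgt; apply/negP => fx0.
pose e := - f (star x * x); have e0 : 0 < e by rewrite oppr_gt0.
pose n := rnorm x; have n0 : 0 <= n by exact: rnormv_ge0.
(* [d <= 1] gives [rnorm y <= n + 1], so [star x * x] and [star y * y] differ by at most
   [d * (2 * n + 1)]; with [2 * n + 2] in the denominator this is strictly below [e]. *)
pose d := Num.min 1 (e / (2 * n + 2)).
have d0 : 0 < d by rewrite lt_min ltr01 divr_gt0//; lra.
have [z [xz [b _ bz]]] : (ball x d%:C `&` range iota) !=set0.
  apply: dA; last by apply: ball_open; rewrite -[0]/(0%:C) ltcR.
  by exists x; apply: ballxx; rewrite -[0]/(0%:C) ltcR.
move: xz; rewrite -ball_normE /= -rnorm_lt_normr -bz => xb.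
have := pos b; set y := iota b in xb *.
have : `|f (star x * x - star y * y)| <= d * (2 * n + 1).
  apply: le_trans (state_norm_le sf _) _.
  have -> : star x * x - star y * y = star x * (x - y) + star (x - y) * y.
    by rewrite mulrBr starB mulrBl addrA subrK.
  apply: le_trans (rnormvD _ _) _.
  apply: le_trans (lerD (cstar_rnormM _ _) (cstar_rnormM _ _)) _.
  rewrite !cstar_rnorm_star -/n [rnorm (x - y) * _]mulrC -mulrDl mulrC.
  have d1 : d <= 1 by rewrite ge_min lexx.
  rewrite ler_pM ?addr_ge0 ?rnormv_ge0 ?(ltW xb)//.
  have : rnorm y <= rnorm (x - y) + n by rewrite rnormvC -{1}(subrK x y) rnormvD.
  by lra.
rewrite (stateD sf) (stateN sf) ler_norml => /andP[h _] h'.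
have : d * (2 * n + 2) <= e.
  by rewrite -ler_pdivlMr; [rewrite ge_min lexx orbT|lra].
rewrite /e; nra.
Qed.

End Positivity.

(** * The GNS representation of a pure state *)

Section GNS.
Variables (R : realType) (A : cstarAlgebra R) (f : A -> R).
Hypotheses (sf : state f) (f_ge0 : forall x, 0 <= f (star x * x)).
Implicit Types (x y z : A) (a : R[i]).

Let B x y := cstate f (star y * x).

Lemma gns_linear a x y z : B (a *: x + y) z = a * B x z + B y z.
Proof. by rewrite /B mulrDr -scalerAr cstate_linear. Qed.

Lemma gns_herm x y : B y x = (B x y)^*.
Proof. by rewrite /B -cstate_star// starM starK. Qed.

Lemma gns_ge0 x : 0 <= complex.Re (B x x).
Proof. exact: f_ge0. Qed.

Definition gns_form : psdForm A := PsdForm gns_linear gns_herm gns_ge0.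

Local Notation N := (psdn gns_form).

Lemma gns_adj x y z : gns_form (x * y) z = gns_form y (star x * z).
Proof. by rewrite /= /B starM starK mulrA. Qed.

Lemma gns_norm_le x : N x <= rnorm x.
Proof.
rewrite -ler_sqr ?nnegrE ?psdn_ge0 ?rnormv_ge0// psdn_sqr -cstar_rnormE.
exact: le_trans (ler_norm _) (state_norm_le sf _).
Qed.

Lemma gns_sqr x y : N (x * y) ^+ 2 <= N (star x * x * y) * N y.
Proof.
rewrite psdn_sqr -[_ * _ * _]mulrA.
have -> : gns_form (x * y) (x * y) = gns_form (star x * (x * y)) y.
  by rewrite [RHS]gns_adj starK.
apply: le_trans (psd_CauchySchwarz _ _ _).
exact: le_trans (ler_norm _) (Re_le_rnorm _).
Qed.

(* Iterating [gns_sqr] along the powers [k ^ (2 ^ n)]. *)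
Lemma gns_sa_bound k y : star k = k -> N (k * y) <= rnorm k * N y.
Proof.
move=> sk; have [y0|y0] := eqVneq (N y) 0.
  have := gns_sqr k y; rewrite y0 mulr0 => h.
  by have := psdn_ge0 gns_form (k * y); nra.
have yp : 0 < N y by rewrite lt_neqAle eq_sym y0 psdn_ge0.
have skn n : star (k ^+ n) = k ^+ n.
  elim: n => [|n IH]; first by rewrite star1.
  by rewrite {1}exprS starM IH sk -exprSr.
have pow n : (N (k * y) / N y) ^+ (2 ^ n) <= N (k ^+ (2 ^ n) * y) / N y.
  elim: n => [|n IH]; first by rewrite expn0 !expr1.
  rewrite expnSr exprM; apply: (@le_trans _ _ ((N (k ^+ (2 ^ n) * y) / N y) ^+ 2)).
    by rewrite ler_sqr ?nnegrE ?exprn_ge0 ?divr_ge0 ?psdn_ge0.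
  rewrite expr_div_n ler_pdivrMr ?exprn_gt0// [N y ^+ 2]expr2 mulrA divfK//.
  by have := gns_sqr (k ^+ (2 ^ n)) y; rewrite skn -exprD addnn -muln2.
set r := N (k * y) / N y in pow.
have r0 : 0 <= r by rewrite divr_ge0 ?psdn_ge0.
suff : r <= rnorm k by rewrite ler_pdivrMr.
have kn n : rnorm (k ^+ n) <= rnorm k ^+ n.
  elim: n => [|n IH]; first by rewrite !expr0 cstar_rnorm1.
  rewrite !exprS; apply: le_trans (cstar_rnormM _ _) _.
  by rewrite ler_wpM2l ?rnormv_ge0.
have powC n : r ^+ (2 ^ n) <= rnorm k ^+ (2 ^ n) * (rnorm y / N y).
  apply: le_trans (pow n) _; rewrite mulrA ler_wpM2r ?invr_ge0 ?psdn_ge0//.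
  apply: le_trans (gns_norm_le _) _; apply: le_trans (cstar_rnormM _ _) _.
  by rewrite ler_wpM2r ?rnormv_ge0.
(* If [rnorm k < r], the powers of [rnorm k / r] tend to 0, whereas [powC] keeps those of exponent
   [2 ^ n], times a fixed constant, at least 1. *)
rewrite leNgt; apply/negP => kr.
have rp : 0 < r by exact: le_lt_trans (rnormv_ge0 _) kr.
pose q := rnorm k / r.
have q01 : 0 <= q < 1 by rewrite divr_ge0 ?rnormv_ge0//= ltr_pdivrMr// mul1r.
pose C := (1 - q)^-1 * (rnorm y / N y).
have [M /(_ (2 ^ M)%N (ltnW (ltn_expl M (ltnSn 1)))) hM] := rate_lt C ltr01.
have h1 : 1 <= q ^+ (2 ^ M) * (rnorm y / N y).
  by rewrite expr_div_n mulrAC ler_pdivlMr ?exprn_gt0// mul1r.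
have h2 : q ^+ (2 ^ M) * (rnorm y / N y) <= C * rate R (2 ^ M).
  rewrite /C mulrAC ler_wpM2r ?divr_ge0 ?rnormv_ge0 ?psdn_ge0//.
  exact: pow_le_rate.
by have := le_lt_trans (le_trans h1 h2) hM; rewrite ltxx.
Qed.

(** One more Cauchy-Schwarz step passes from [x] to the selfadjoint [star x * x], whose norm is
    [rnorm x ^+ 2]. *)
Lemma gns_bound x y : N (x * y) <= rnorm x * N y.
Proof.
rewrite -ler_sqr ?nnegrE ?mulr_ge0 ?psdn_ge0 ?rnormv_ge0//.
apply: le_trans (gns_sqr x y) _; rewrite exprMn expr2 mulrA ler_wpM2r ?psdn_ge0//.
rewrite -expr2 -cstar_rnormE; apply: gns_sa_bound.
by rewrite starM starK.
Qed.

Local Notation H := (hcompl gns_form).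

Lemma represents_gns x u (g : H) : represents gns_form u g ->
  represents gns_form (fun n => x * u n) (fun y => g (star x * y)).
Proof.
move=> [c ug]; exists (`|c| * rnorm x) => n y; rewrite gns_adj.
apply: le_trans (ug n _) _.
apply: (@le_trans _ _ (`|c| * rate R n * N (star x * y))).
  rewrite -!mulrA ler_wpM2r ?mulr_ge0 ?psdn_ge0 ?(ltW (rate_gt0 _ _))//.
  exact: ler_norm.
have -> : `|c| * rnorm x * rate R n * N y = `|c| * rate R n * (rnorm x * N y) by ring.
rewrite ler_wpM2l ?mulr_ge0 ?(ltW (rate_gt0 _ _))// -cstar_rnorm_star.
exact: gns_bound.
Qed.

(** As a function, the image of [g] is [y |-> g (star x * y)]; the representing sequence enters only
    in the membership proof, so the algebraic laws can be checked pointwise. *)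
Definition gns_op x (g : H) : H :=
  HCompl (represents_hcompl (represents_gns x (hreprP g))).

Lemma gns_op_bound x (g : H) : rnorm (gns_op x g) <= rnorm x * rnorm g.
Proof.
have xu : represents gns_form (fun n => x * hrepr g n) (gns_op x g).
  exact: represents_gns (hreprP g).
have uu := hinner_cvg (hreprP g) (hreprP g).
have xuxu := hinner_cvg xu xu.
rewrite !rnorm_hcompl -ler_sqr ?nnegrE ?mulr_ge0 ?psdn_ge0 ?rnormv_ge0//.
rewrite exprMn !psdn_sqr /=.
rewrite -subr_ge0.
have : 0 <= complex.Re ((rnorm x ^+ 2)%:C * hinner g g + - 1 * hinner (gns_op x g) (gns_op x g)).
  apply: rate_cvg_Re_ge (rate_cvgD (rate_cvgM _ uu) (rate_cvgM _ xuxu)) _ => n.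
  rewrite !psdE mulN1r -rmorphM -rmorphN -rmorphD /= subr_ge0 -exprMn.
  by rewrite ler_sqr ?nnegrE ?mulr_ge0 ?psdn_ge0 ?rnormv_ge0// gns_bound.
by rewrite mulN1r raddfB /=; case: (hinner g g) => a b /=; rewrite mul0r subr0.
Qed.

Lemma gns_op_linear x : linear (gns_op x).
Proof. by move=> a g h; apply: hcompl_eq. Qed.

Lemma gns_op_continuous x : continuous (gns_op x).
Proof.
apply: (@lipschitz_continuous_rnorm R _ _ _ (rnorm x)) => g h.
have -> : gns_op x g - gns_op x h = gns_op x (g - h) by exact: hcompl_eq.
exact: gns_op_bound.
Qed.

Lemma gns_opD x y (g : H) : gns_op (x + y) g = gns_op x g + gns_op y g.
Proof.
apply: hcompl_eq => z; rewrite /= starD mulrDl.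
by have := hcompl_semilinear g 1 (star x * z) (star y * z); rewrite scale1r rmorph1 mul1r.
Qed.

Lemma gns_opZ a x (g : H) : gns_op (a *: x) g = a *: gns_op x g.
Proof.
apply: hcompl_eq => z; rewrite /= starZ -scalerAl.
have := hcompl_semilinear g (a^*) (star x * z) 0; rewrite addr0 => ->.
rewrite conjCK; have := hcompl_semilinear g 1 0 0.
by rewrite scaler0 addr0 rmorph1 mul1r => /(congr1 (+%R^~ (- g 0)));
  rewrite addrK subrr => <-; rewrite addr0.
Qed.

Lemma gns_opM x y (g : H) : gns_op (x * y) g = gns_op x (gns_op y g).
Proof. by apply: hcompl_eq => z; rewrite /= starM mulrA. Qed.

Lemma gns_op_star x (g h : H) : hinner (gns_op x g) h = hinner g (gns_op (star x) h).
Proof.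
have xu := represents_gns x (hreprP g).
have sv := represents_gns (star x) (hreprP h).
have h1 := @hinner_cvg _ _ _ (gns_op x g) h _ _ xu (hreprP h).
have h2 := @hinner_cvg _ _ _ g (gns_op (star x) h) _ _ (hreprP g) sv.
apply: (rate_cvg_unique h1).
by under eq_fun do rewrite gns_adj.
Qed.

Definition gns_rep : starRep A (hcompl_hilbert gns_form) :=
  @StarRep R A (hcompl_hilbert gns_form) gns_op gns_op_linear gns_op_continuous
    gns_opD gns_opZ gns_opM gns_op_star.

Definition gns_vector : hcompl_hilbert gns_form := hembed gns_form 1.

Lemma gns_op1 g : gns_rep 1 g = g.
Proof. by apply: hcompl_eq => z; rewrite /= star1 mul1r. Qed.

Lemma gns_op_vector x : gns_rep x gns_vector = hembed gns_form x.
Proof. by apply: hcompl_eq => z; rewrite /= /B mulr1 starM starK. Qed.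

Lemma gns_vector_state x : complex.Re (inner _ (gns_rep x gns_vector) gns_vector) = f x.
Proof. by rewrite gns_op_vector /= hinner_embed /= /B star1 mul1r. Qed.

Lemma gns_vector_rnorm : rnorm gns_vector = 1.
Proof.
rewrite [LHS]rnorm_hcompl psdn_hembed; apply: psdnE => //.
by have [_ _ f1] := sf; rewrite /= /B star1 mulr1 f1 expr1n.
Qed.

Lemma gns_cyclic (v : hcompl_hilbert gns_form) :
  exists x : nat -> A, rate_cvg (fun n => gns_rep (x n) gns_vector) v.
Proof.
have [u uv] := hcomplP (v : H); exists u.
have [c hc] := represents_cvg uv; exists c => n.
by rewrite gns_op_vector; exact: hc.
Qed.

End GNS.

(** * Orthogonal projection onto a closed subspace *)

Section Projection.
Variables (R : realType) (H : hilbertSpace R) (V : set H).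
Hypotheses (sV : linear_subspace V) (cV : closed V).

Local Notation N := (psdn (inner_form H)).

Lemma orthogonal_projection (x : H) :
  exists2 v, V v & forall w, V w -> inner H (x - v) w = 0.
Proof.
have [V0 VD] := sV.
pose E := [set N (x - v) | v in V]; pose d := inf E.
have E0 : E !=set0 by exists (N (x - 0)), 0.
have lbE : has_lbound E by exists 0 => _ [v _ <-]; exact: psdn_ge0.
have dle v : V v -> d <= N (x - v) by move=> Vv; apply: ge_inf => //; exists v.
have d0 : 0 <= d by apply: lb_le_inf => // _ [v _ <-]; exact: psdn_ge0.
(* The error is a squared rate because the parallelogram law controls the square of the distance
   between [v n] and [v m]. *)
have approx n : exists v, V v /\ N (x - v) <= d + rate R n ^+ 2.
  have [_ [v Vv <-] /ltW h] := inf_adherent (exprn_gt0 2 (rate_gt0 R n)) (conj E0 lbE).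
  by exists v.
have [v vP] := choice approx.
have vcau : rate_cauchy v.
  (* Twice the coefficient [2 * d + 1] of [a2] and [b2] below; [K >= 1] then allows [K] to be
     replaced by [K ^+ 2]. *)
  pose K := 4 * d + 2; exists K => n m.
  have K0 : 2 <= K by rewrite /K; lra.
  have [Vn hn] := vP n; have [Vm hm] := vP m.
  have rn := rate_gt0 R n; have rm := rate_gt0 R m.
  rewrite -psdn_inner -ler_sqr ?nnegrE ?psdn_ge0 ?addr_ge0 ?mulr_ge0 ?(ltW rn) ?(ltW rm)//; try lra.
  have := psd_parallelogram (inner_form H) (x - v n) (x - v m).
  have -> : x - v n - (x - v m) = v m - v n.
    by rewrite opprB addrC addrA subrK.
  have -> : x - v n + (x - v m) = 2%:R *: (x - 2%:R^-1 *: (v n + v m)).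
    rewrite scalerBr scalerA mulfV ?pnatr_eq0// scale1r scaler_nat mulr2n.
    by rewrite addrACA opprD.
  have -> : N (2%:R *: (x - 2%:R^-1 *: (v n + v m))) = 2 * N (x - 2%:R^-1 *: (v n + v m)).
    rewrite psdnZ; congr (_ * _).
    by rewrite -(rmorph_nat (real_complex R)) rnorm_real ger0_norm.
  rewrite (psdnC _ (v n)).
  have /dle : V (2%:R^-1 *: (v n + v m)).
    rewrite scalerDr -[X in _ + X]addr0; apply: (VD _ (v n)) => //.
    exact: VD.
  have := rate_le1 R n; have := rate_le1 R m.
  have := dle _ Vn; have := dle _ Vm.
  move: (N (x - 2%:R^-1 *: _)) (N (x - v n)) (N (x - v m)) (N (v m - v n)) hn hm.
  move: (rate R n) (rate R m) rn rm => r t r0 t0 p a b e ha hb db da t1 r1 dp par.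
  have a2 : a ^+ 2 <= d ^+ 2 + (2 * d + 1) * r ^+ 2.
    have : a ^+ 2 <= (d + r ^+ 2) ^+ 2.
      by rewrite ler_sqr ?nnegrE ?addr_ge0 ?sqr_ge0//; lra.
    have : r ^+ 2 * r ^+ 2 <= r ^+ 2 * 1 by rewrite ler_wpM2l ?sqr_ge0// expr_le1// ltW.
    by rewrite sqrrD; lra.
  have b2 : b ^+ 2 <= d ^+ 2 + (2 * d + 1) * t ^+ 2.
    have : b ^+ 2 <= (d + t ^+ 2) ^+ 2.
      by rewrite ler_sqr ?nnegrE ?addr_ge0 ?sqr_ge0//; lra.
    have : t ^+ 2 * t ^+ 2 <= t ^+ 2 * 1 by rewrite ler_wpM2l ?sqr_ge0// expr_le1// ltW.
    by rewrite sqrrD; lra.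
  have p2 : d ^+ 2 <= p ^+ 2 by rewrite ler_sqr ?nnegrE//; lra.
  have e2 : e ^+ 2 <= K * (r ^+ 2 + t ^+ 2).
    by move: par; rewrite exprMn /K; lra.
  apply: le_trans e2 _.
  have rt : 0 <= r * t by rewrite mulr_ge0// ltW.
  have K1 : K * (r ^+ 2 + t ^+ 2) <= K ^+ 2 * (r ^+ 2 + t ^+ 2).
    by rewrite ler_wpM2r ?addr_ge0 ?sqr_ge0// expr2; nra.
  apply: le_trans K1 _; have -> : (K * r + K * t) ^+ 2 =
      K ^+ 2 * (r ^+ 2 + t ^+ 2) + 2 * (K ^+ 2 * (r * t)) by ring.
  by rewrite lerDl mulr_ge0// mulr_ge0// sqr_ge0.
have [l [c hc]] := rate_cauchy_cvg vcau.
have Vl : V l by apply: (rate_cvg_closed cV _ (ex_intro _ c hc)) => n; exact: (vP n).1.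
exists l => // w Vw.
have xl : N (x - l) <= d.
  apply: (@ler_rate _ _ _ (1 + c)) => n; apply: le_trans (psdn_dist _ (v n) _ _) _.
  have [_ hn] := vP n.
  have := hc n; rewrite -psdn_inner (psdnC _ l).
  have : rate R n ^+ 2 <= rate R n.
    by rewrite expr2 ler_piMr ?rate_le1// ltW// rate_gt0.
  by lra.
(* Moving [l] by [s * b] along [w] changes the squared distance by
   [s * rnorm b ^+ 2 * (s * N w ^+ 2 - 2)], negative unless [b = 0]; the added 1 covers [w = 0]. *)
pose b := inner H (x - l) w; pose s := (N w ^+ 2 + 1)^-1.
have := psdn_sqr_subZ (inner_form H) (x - l) w s; rewrite /= -/b.
set y := x - l - _.
have : N (x - l) ^+ 2 <= N y ^+ 2.
  rewrite ler_sqr ?nnegrE ?psdn_ge0//; apply: le_trans xl _.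
  have -> : y = x - ((s%:C * b) *: w + l) by rewrite /y opprD addrA addrAC.
  exact/dle/VD.
move=> h1 h2; have w1 : 0 < N w ^+ 2 + 1 by rewrite ltr_wpDl ?sqr_ge0.
have s0 : 0 < s by rewrite invr_gt0.
have sw : s * N w ^+ 2 <= 1.
  by rewrite mulrC ler_pdivrMr// mul1r lerDl.
have : rnorm b ^+ 2 <= 0.
  rewrite leNgt; apply/negP => b0.
  have : s * rnorm b ^+ 2 * (s * N w ^+ 2) <= s * rnorm b ^+ 2 * 1.
    by rewrite ler_wpM2l// mulr_ge0 ?sqr_ge0// ltW.
  have : 0 < s * rnorm b ^+ 2 by rewrite mulr_gt0.
  by move: h1; rewrite h2; lra.
move=> b0; apply: rnormv_eq0; apply/eqP; rewrite -sqrf_eq0 eq_le b0.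
exact: sqr_ge0.
Qed.

End Projection.

Section VectorState.
Variables (R : realType) (A : cstarAlgebra R) (H : hilbertSpace R) (pi : starRep A H).
Hypothesis pi_le : forall x u, rnorm (pi x u) <= rnorm x * rnorm u.
Hypothesis pi1 : forall u, pi 1 u = u.

Lemma vector_state (v : H) : v != 0 ->
  state (fun x => complex.Re (inner H (pi x v) v) / rnorm v ^+ 2).
Proof.
move=> v0; have vp : 0 < rnorm v.
  rewrite lt_neqAle rnormv_ge0 andbT eq_sym; apply: contra v0 => /eqP/rnormv_eq0 ->.
  by [].
have v2 : 0 < rnorm v ^+ 2 by rewrite exprn_gt0.
split.
- move=> r x y; rewrite mulrA -mulrDl; congr (_ / _).
  have -> : ((r *: x + y : realified A) : A) = r%:C *: (x : A) + (y : A) by [].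
  rewrite repD repZ inner_linear; case: (inner H (pi x v) v) => a b.
  by rewrite raddfD /= mul0r subr0.
- move=> x; rewrite ler_pdivrMr//.
  (* The real part sees only the selfadjoint part of [x], which is why [sa_norm], and not just the
     norm, is a bound. *)
  have star_inv : complex.Re (inner H (pi (star x) v) v) = complex.Re (inner H (pi x v) v).
    by rewrite rep_star starK inner_herm complex_Re_conj.
  have -> : complex.Re (inner H (pi x v) v) =
      complex.Re (inner H (pi (x + star x) v) v) / 2.
    rewrite repD -[pi x v]scale1r inner_linear mul1r scale1r raddfD /= star_inv.
    by rewrite -mulr2n -[_ *+ 2]mulr_natr mulfK.
  rewrite /sa_norm mulrAC ler_wpM2r ?invr_ge0//.
  apply: le_trans (ler_norm _) _; apply: le_trans (Re_le_rnorm _) _.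
  have := psd_CauchySchwarz (inner_form H) (pi (x + star x) v) v.
  move=> /le_trans; apply; rewrite !psdn_inner expr2 mulrA.
  by rewrite ler_wpM2r ?rnormv_ge0.
- by rewrite pi1 inner_rnorm /= divff// lt0r_neq0.
Qed.

End VectorState.

Section Irreducible.
Variables (R : realType) (A : cstarAlgebra R) (H : hilbertSpace R) (pi : starRep A H).
Variables (xi : H) (f : A -> R).
Hypothesis pi_le : forall x u, rnorm (pi x u) <= rnorm x * rnorm u.
Hypothesis pi1 : forall u, pi 1 u = u.
Hypothesis cyclic_xi : forall w, exists x : nat -> A, rate_cvg (fun n => pi (x n) xi) w.
Hypothesis fE : forall x, f x = complex.Re (inner H (pi x xi) xi).
Hypothesis pf : pure_state f.

Lemma innerBl (u v w : H) : inner H (u - v) w = inner H u w - inner H v w.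
Proof. exact: (psdBl (inner_form H)). Qed.

(** Real parts suffice: [w] is a limit of vectors [pi (x n) xi], so [rnorm w ^+ 2] is the limit of
    the real parts of their inner products with [w]. *)
Lemma cyclic_orthogonal (w : H) :
  (forall x, complex.Re (inner H (pi x xi) w) = 0) -> w = 0.
Proof.
move=> hw; apply: rnormv_eq0; apply/eqP; rewrite -sqrf_eq0 eq_le sqr_ge0 andbT.
have [x [c hc]] := cyclic_xi w.
apply: (@ler_rate _ _ _ (c * rnorm w)) => n; rewrite add0r.
have -> : rnorm w ^+ 2 = complex.Re (inner H (w - pi (x n) xi) w).
  by rewrite innerBl raddfB /= hw subr0 inner_rnorm.
apply: le_trans (ler_norm _) _; apply: le_trans (Re_le_rnorm _) _.
have := psd_CauchySchwarz (inner_form H) (w - pi (x n) xi) w.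
move=> /le_trans; apply; rewrite !psdn_inner mulrAC ler_wpM2r ?rnormv_ge0//.
Qed.

(* For an invariant closed [V], the components of the cyclic vector along [V]
   and its complement write [f] as a convex combination of vector states. *)
Lemma pure_irreducible : irreducible pi.
Proof.
split.
  exists 1, xi => xi0; have [[_ _ f1] _] := pf.
  have i0 : inner H 0 xi = 0 := psd0l (inner_form H) xi.
  by move: f1; rewrite fE xi0 i0 => /esym/eqP; rewrite oner_eq0.
move=> V sV cV iV; have [v Vv uV] := orthogonal_projection sV cV xi.
set u := xi - v in uV; have xiE : xi = v + u by rewrite addrC subrK.
clearbody u.
have [v0|v0] := eqVneq v 0.
  left; apply/seteqP; split=> [w Vw|_ ->]; last exact: sV.1.
  apply: cyclic_orthogonal => x; rewrite rep_star.
  have -> : xi = u by rewrite xiE v0 add0r.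
  by rewrite uV//; exact: iV.
have [u0|u0] := eqVneq u 0.
  right; apply/seteqP; split=> // w _.
  have [x xw] := cyclic_xi w.
  apply: (rate_cvg_closed cV _ xw) => n; apply: iV.
  by move: Vv; rewrite -/xi xiE u0 addr0.
exfalso.
have piD x (a b : H) : pi x (a + b) = pi x a + pi x b.
  by have := rep_linear pi x 1 a b; rewrite !scale1r.
have innerDr (a b c : H) : inner H a (b + c) = inner H a b + inner H a c.
  exact: (psdDr (inner_form H)).
have innerDl (a b c : H) : inner H (a + b) c = inner H a c + inner H b c.
  exact: (psdDl (inner_form H)).
have uv0 x : inner H (pi x u) v = 0 by rewrite rep_star uV//; exact: iV.
have vu0 x : inner H (pi x v) u = 0.
  by rewrite inner_herm uV ?rmorph0//; exact: iV.
have split_f x : f x = complex.Re (inner H (pi x v) v) + complex.Re (inner H (pi x u) u).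
  have -> : f x = complex.Re (inner H (pi x (v + u)) (v + u)) by rewrite fE -xiE.
  by rewrite piD innerDl !innerDr uv0 vu0 addr0 add0r raddfD.
pose t := rnorm v ^+ 2.
have norm_sum : t + rnorm u ^+ 2 = 1.
  have := split_f 1; rewrite !pi1 !inner_rnorm /= => <-.
  by have [[_ _]] := pf.
have gt0 (w : H) : w != 0 -> 0 < rnorm w ^+ 2.
  move=> w0; rewrite exprn_gt0// lt_neqAle rnormv_ge0 andbT eq_sym.
  by apply: contra w0 => /eqP/rnormv_eq0 ->.
have t0 : 0 < t := gt0 _ v0; have u2 := gt0 _ u0.
have t01 : 0 < t < 1 by apply/andP; split => //; lra.
have := pf.2 _ _ _ t01 (vector_state pi_le pi1 v0) (vector_state pi_le pi1 u0).
have tE : 1 - t = rnorm u ^+ 2 by lra.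
have conv x : f x = t * (complex.Re (inner H (pi x v) v) / rnorm v ^+ 2) +
    (1 - t) * (complex.Re (inner H (pi x u) u) / rnorm u ^+ 2).
  by rewrite split_f tE /t; field; rewrite -!(sqrf_eq0 (rnorm _)) !lt0r_neq0.
move=> /(_ conv) /funeqP fvE.
(* By purity the vector state of [v] is [f], so [v] and [t%:C *: xi] pair alike with the orbit of
   [xi]. Then [xi] is orthogonal to [u] along with [v], although its component along [u] is [u]
   itself. *)
have : t%:C *: xi - v = 0.
  apply: cyclic_orthogonal => x.
  have := psdBr (inner_form H) (pi x xi) (t%:C *: xi) v; rewrite /= => ->.
  have := psdZr (inner_form H) t%:C (pi x xi) xi; rewrite /= => ->.
  rewrite [_^*]conjc_real raddfB /=.
  have -> : complex.Re (t%:C * inner H (pi x xi) xi) = t * f x.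
    by rewrite fE; case: (inner H (pi x xi) xi) => a b /=; rewrite mul0r subr0.
  have -> : inner H (pi x xi) v = inner H (pi x v) v.
    by rewrite {1}xiE piD innerDl uv0 addr0.
  by rewrite -(fvE x) mulrC divfK ?subrr// lt0r_neq0.
move=> /eqP; rewrite subr_eq0 => /eqP vE.
have : inner H xi u = 0.
  have h : inner H v u = 0 by rewrite inner_herm uV ?rmorph0.
  have := psdZl (inner_form H) t%:C xi u; rewrite /= vE h => /esym/eqP.
  rewrite mulf_eq0 => /orP[|/eqP//].
  by rewrite -[0]/(0%:C) (inj_eq (@complexI _)) (gt_eqF t0).
rewrite {1}xiE innerDl inner_herm uV// rmorph0 add0r inner_rnorm.
by move=> /(congr1 (@complex.Re R)) /= /eqP; rewrite (gt_eqF u2).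
Qed.

End Irreducible.

(** * Primitive ideals *)

Section Enveloping.
Variables (R : realType) (B : starAlgType R) (A : cstarAlgebra R).
Variables (iota : {lrmorphism B -> A}) (AE : enveloping_cstar iota).
Implicit Types a b x : A.

Lemma noninvertible_irreducible a : ~ invertible (star a * a) ->
  exists (H : hilbertSpace R) (pi : starRep A H) (xi : H),
    [/\ irreducible pi, forall x u, rnorm (pi x u) <= rnorm x * rnorm u,
        forall u, pi 1 u = u, xi <> 0 & pi a xi = 0].
Proof.
move=> aN; have [|f [pf fa]] := @ex_pure_state _ _ (star a * a) _ aN.
  by rewrite starM starK.
have sf := pf.1; have f_ge0 x := state_ge0 AE x sf.
exists (hcompl_hilbert (gns_form sf f_ge0)), (gns_rep sf f_ge0), (gns_vector sf f_ge0).
split.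
- apply: (@pure_irreducible _ _ _ _ (gns_vector sf f_ge0) f) => //.
  + exact: gns_op_bound.
  + exact: gns_op1.
  + exact: gns_cyclic.
  + by move=> x; rewrite gns_vector_state.
- exact: gns_op_bound.
- exact: gns_op1.
- move=> xi0; have := gns_vector_rnorm sf f_ge0.
  by rewrite xi0 rnormv0 => /eqP; rewrite eq_sym oner_eq0.
(* The squared norm is [f (star a * a)], nonpositive by the choice of [f] and nonnegative by
   positivity. *)
- rewrite gns_op_vector; apply: rnormv_eq0.
  rewrite [LHS]rnorm_hcompl psdn_hembed; apply: psdnE => //.
  by apply/eqP; rewrite expr0n /= eq_le fa f_ge0.
Qed.

Lemma rep_ker_closed (H : hilbertSpace R) (pi : starRep A H) :
  (forall x u, rnorm (pi x u) <= rnorm x * rnorm u) -> closed (rep_ker pi).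
Proof.
move=> pi_le.
have -> : rep_ker pi = \bigcap_(u in [set: H]) ((fun x => pi x u) @^-1` [set 0]).
  by apply/seteqP; split=> x h u; [move=> _|]; exact: h.
apply: closed_bigI => u _; apply: preimage_closed; last first.
  exact/accessible_closed_set1/hausdorff_accessible/norm_hausdorff.
move=> x _; move: x; apply: (@lipschitz_continuous_rnorm R A H (fun x => pi x u) (rnorm u)) => y z.
rewrite mulrC -[pi y u - _]/(_) -scaleN1r -repZ -repD scaleN1r; exact: pi_le.
Qed.

Lemma rep_ker_ideal (H : hilbertSpace R) (pi : starRep A H) :
  (forall x u, rnorm (pi x u) <= rnorm x * rnorm u) -> irreducible pi ->
  exists2 I : closedIdeal A, Prim A I & ideal_set I = rep_ker pi.
Proof.
move=> pi_le pi_irr.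
have pi0 x : pi x 0 = 0.
  by apply: rnormv_eq0; apply/eqP; rewrite eq_le rnormv_ge0 andbT;
    have := pi_le x 0; rewrite rnormv0 mulr0.
have k0 : rep_ker pi 0.
  by move=> u; apply: rnormv_eq0; apply/eqP; rewrite eq_le rnormv_ge0 andbT;
    have := pi_le 0 u; rewrite rnormv0 mul0r.
have kB x y : rep_ker pi x -> rep_ker pi y -> rep_ker pi (x - y).
  by move=> hx hy u; rewrite -scaleN1r repD repZ hx hy scaler0 addr0.
have kMl x y : rep_ker pi y -> rep_ker pi (x * y).
  by move=> hy u; rewrite repM hy.
have kMr x y : rep_ker pi y -> rep_ker pi (y * x).
  by move=> hy u; rewrite repM hy.
exists (ClosedIdeal k0 kB kMl kMr (rep_ker_closed pi_le)) => //.
by exists H, pi.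
Qed.

Lemma invertible_Phi (I : closedIdeal A) a : invertible a -> invertible (Phi I a).
Proof.
by move=> [b [ab ba]]; exists (Phi I b); rewrite -!rmorphM ab ba rmorph1.
Qed.

Lemma left_invertible_of_Prim a :
  (forall I : closedIdeal A, Prim A I -> exists y, y * Phi I a = 1) ->
  invertible (star a * a).
Proof.
move=> aI; apply: contrapT => /noninvertible_irreducible[H [pi [xi [irr pi_le pi1 xi0 axi]]]].
have [I PI IE] := rep_ker_ideal pi_le irr.
have [y] := aI I PI; rewrite -[y]quot_reprK; set b := quot_repr y => ba.
have : ideal_set I (b * a - 1) by apply/Phi_eqP; rewrite rmorphM ba rmorph1.
rewrite IE => /(_ xi).
rewrite -scaleN1r repD repZ repM axi pi1 scaleN1r.
move=> h; apply: xi0; apply/eqP; rewrite -oppr_eq0; apply/eqP.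
rewrite -h; have := pi_le b 0; rewrite rnormv0 mulr0 => b0.
have -> : pi b 0 = 0 by apply: rnormv_eq0; apply/eqP; rewrite eq_le b0 rnormv_ge0.
by rewrite add0r.
Qed.

(** Adjoints exchange the two sides, provided that the ideal is stable under [star]. A [closedIdeal]
    does not record this; it follows from the ideal being the kernel of a star representation, where
    [pi c = 0] forces [pi (star c) u] to have norm zero. *)
Lemma right_invertible_of_Prim a :
  (forall I : closedIdeal A, Prim A I -> exists y, Phi I a * y = 1) ->
  invertible (a * star a).
Proof.
move=> aI; have := @left_invertible_of_Prim (star a); rewrite starK; apply=> I PI.
have [y] := aI I PI; rewrite -[y]quot_reprK; set b := quot_repr y => ab.
exists (Phi I (star b)); rewrite -rmorphM -starM.
have : ideal_set I (a * b - 1) by apply/Phi_eqP; rewrite rmorphM ab rmorph1.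
have [H [pi [irr IE]]] := PI; rewrite IE => h.
rewrite -(rmorph1 (Phi I)); apply/Phi_eqP; rewrite IE => u.
have -> : star (a * b) - 1 = star (a * b - 1) by rewrite starB star1.
apply: rnormv_eq0; apply/eqP; rewrite -sqrf_eq0; apply/eqP.
have -> : rnorm (pi (star (a * b - 1)) u) ^+ 2 =
    complex.Re (inner H (pi (star (a * b - 1)) u) (pi (star (a * b - 1)) u)).
  by rewrite inner_rnorm.
rewrite rep_star starK h.
have h0 := psd0l (inner_form H) u; rewrite /= in h0.
by rewrite inner_herm h0 rmorph0.
Qed.

Theorem invertible_iff_Prim a :
  invertible a <-> forall I : closedIdeal A, Prim A I -> invertible (Phi I a).
Proof.
split=> [ia I _|aI]; first exact: invertible_Phi.
have [|x [_ xl]] := @left_invertible_of_Prim a.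
  by move=> I /aI[y [_ ya]]; exists y.
have [|z [zr _]] := @right_invertible_of_Prim a.
  by move=> I /aI[y [ay _]]; exists y.
have l : x * star a * a = 1 by rewrite -mulrA.
have r : a * (star a * z) = 1 by rewrite mulrA.
have lr : x * star a = star a * z by rewrite -[LHS]mulr1 -r mulrA l mul1r.
by exists (x * star a); split=> //; rewrite lr.
Qed.

End Enveloping.

Theorem theorem5p1 (R : realType) (G : groupType)
    (countableG : countable [set: G]) (nilpotentG : nilpotent_group G)
    (A : cstarAlgebra R) (iota : {lrmorphism ell1 R G -> A})
    (AE : group_cstar iota) (a : A) :
  invertible a <->
  forall I : closedIdeal A, Prim A I -> invertible (Phi I a).
Proof. exact: (invertible_iff_Prim AE). Qed.
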